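(* Let $0\le\eta<1$, $m\in\mathbb{N}$, $n\in\mathbb{N}_0$, $m>n$. If $f_{m,j}\in\overline{S}H(m,n,\eta)$ for $j=1,2,\dots$, with $f_{m,j}(z)=z-\sum_{k=2}^{\infty}|a_{k,j}|z^k+(-1)^{m-1}\sum_{k=1}^{\infty}|b_{k,j}|\overline{z}^k$, and $t_j\ge0$ with $\sum_{j=1}^{\infty}t_j=1$, then $\sum_{j=1}^{\infty}t_jf_{m,j}\in\overline{S}H(m,n,\eta)$. That is, $\overline{S}H(m,n,\eta)$ is closed under convex combination.
   Context: Fix real parameters $\alpha,\beta,\gamma,\delta>0$ and $p,q>0$ with $q\le \alpha+p$. For an integer $m\ge 0$ define $C_1(m)=1$ and, for $k\ge 2$, $$C_k(m)=\frac{(m+1)_{k-1}}{(k-1)!}\cdot\frac{\Gamma(\gamma+q(k-1))/\Gamma(\gamma)}{\Gamma(\beta+\alpha(k-1))\,\Gamma(\delta+p(k-1))/\Gamma(\delta)},$$ where $(x)_j=\Gamma(x+j)/\Gamma(x)$. For analytic $\varphi(z)=\sum_{k\ge1}c_kz^k$ on $U=\{|z|<1\}$ set $\Phi^m\varphi(z)=\sum_{k\ge1}C_k(m)c_kz^k$, and for harmonic $f=h+\overline{g}$ set $\Phi^m f=\Phi^m h+(-1)^m\overline{\Phi^m g}$. The class $SH(m,n,\eta)$ consists of harmonic $f=h+\overline g$, univalent and sense-preserving in $U$, with $h(z)=z+\sum_{k\ge2}a_kz^k$, $g(z)=\sum_{k\ge1}b_kz^k$, $|b_1|<1$, and $\operatorname{Re}\bigl(\Phi^m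 f/\Phi^n f\bigr)>\eta$ in $U$. The class $\overline{S}H(m,n,\eta)$ consists of those $f_m=h+\overline{g_m}\in SH(m,n,\eta)$ with $h(z)=z-\sum_{k\ge2}a_kz^k$, $g_m(z)=(-1)^{m-1}\sum_{k\ge1}b_kz^k$, $a_k,b_k\ge0$. *)

(* Defs.v *)
From Stdlib Require Import Reals Arith Factorial.
From Coquelicot Require Import Coquelicot.
Open Scope R_scope.

(* Euler's Gamma function (used only at positive arguments):
   Gamma(x) = \int_0^oo t^(x-1) e^(-t) dt. *)
Definition Gamma (x : R) : R :=
  RInt_gen (fun t => Rpower t (x - 1) * exp (- t)) (at_right 0) (Rbar_locally p_infty).

Definition poch (x : R) (j : nat) : R := Gamma (x + INR j) / Gamma x.

(* The coefficient multipliers C_k(m) (with C_0 := 1, C_1 := 1; C_0 is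
   irrelevant since all coefficient sequences vanish at index 0). *)
Definition Ck (alpha beta gamma delta p q : R) (m k : nat) : R :=
  match k with
  | O | S O => 1
  | S k1 =>
      (poch (INR m + 1) k1 / INR (fact k1)) *
      ((Gamma (gamma + q * INR k1) / Gamma gamma) /
       (Gamma (beta + alpha * INR k1) * Gamma (delta + p * INR k1) / Gamma delta))
  end.

Definition cpseries (c : nat -> Complex.C) (z l : Complex.C) : Prop :=
  is_pseries (K := C_AbsRing) (V := C_NormedModule) c z l.

Definition cderive (f : Complex.C -> Complex.C) (z l : Complex.C) : Prop :=
  is_derive (K := C_AbsRing) (V := C_NormedModule) f z l.

Definition PhiC (alpha beta gamma delta p q : R) (m : nat) (c : nat -> Complex.C)
  : nat -> Complex.C :=
  fun k => Complex.Cmult (Complex.RtoC (Ck alpha beta gamma delta p q m k)) (c k).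

Definition hcoef (a : nat -> R) : nat -> Complex.C :=
  fun k => match k with O => Complex.RtoC 0 | S O => Complex.RtoC 1
                    | _ => Complex.RtoC (- a k) end.

(* coefficients of g_m(z) = (-1)^(m-1) sum_{k>=1} b_k z^k
   (written (-1)^(m+1), equal to (-1)^(m-1)) *)
Definition gcoef (m : nat) (b : nat -> R) : nat -> Complex.C :=
  fun k => match k with O => Complex.RtoC 0
                    | _ => Complex.RtoC ((-1) ^ (m + 1) * b k) end.

Definition inU (z : Complex.C) : Prop := Complex.Cmod z < 1.

(* Phi^m f for f = h + conj g :  Phi^m h + (-1)^m conj (Phi^m g) *)
Definition PhiHarm (m : nat) (Hm Gm : Complex.C) : Complex.C :=
  Complex.Cplus Hm (Complex.Cmult (Complex.RtoC ((-1) ^ m)) (Complex.Cconj Gm)).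

Definition SHbar (alpha beta gamma delta p q : R) (m n : nat) (eta : R)
    (f : Complex.C -> Complex.C) : Prop :=
  exists (a b : nat -> R),
    (forall k, 0 <= a k) /\ (forall k, 0 <= b k) /\
    exists (H G : Complex.C -> Complex.C),
      (forall z, inU z ->
         cpseries (hcoef a) z (H z) /\ cpseries (gcoef m b) z (G z) /\
         f z = Complex.Cplus (H z) (Complex.Cconj (G z))) /\
      Rabs (b 1%nat) < 1 /\
      (forall z w, inU z -> inU w -> f z = f w -> z = w) /\
      (* sense-preserving in U : |g'| < |h'| *)
      (forall z, inU z -> exists dH dG,
         cderive H z dH /\ cderive G z dG /\ Complex.Cmod dG < Complex.Cmod dH) /\
      (* Re (Phi^m f / Phi^n f) > eta in U (z <> 0, where the quotient is defined) *)
      (forall z, inU z -> z <> Complex.RtoC 0 ->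
         exists Hm Gm Hn Gn,
           cpseries (PhiC alpha beta gamma delta p q m (hcoef a)) z Hm /\
           cpseries (PhiC alpha beta gamma delta p q m (gcoef m b)) z Gm /\
           cpseries (PhiC alpha beta gamma delta p q n (hcoef a)) z Hn /\
           cpseries (PhiC alpha beta gamma delta p q n (gcoef m b)) z Gn /\
           PhiHarm n Hn Gn <> Complex.RtoC 0 /\
           eta < Complex.Re (Complex.Cdiv (PhiHarm m Hm Gm) (PhiHarm n Hn Gn))).

(* Main.v *)
Require Import Defs.
From Stdlib Require Import Reals Ranalysis5 Factorial Lra Lia Psatz Classical IndefiniteDescription.
From Coquelicot Require Import Coquelicot.
Open Scope R_scope.

(** Write [M], [N] for the multipliers [C_k(m)], [C_k(n)]; since
    [Gamma (n + 1) = n!], [0 <= N <= M]. Membership in the class turns out to be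
    equivalent to two families of linear inequalities on the coefficients,
    [sum_k k (a_k + b_k) <= 1] and
    [sum_k (M - eta N) a_k + (M + (-1)^(m+n+1) eta N) b_k <= 1 - eta],
    both with strict inequality for the [k = 1] term alone, and linear
    inequalities survive convex combinations.

    Necessity: on the positive real axis [h' > 0] and [Phi^n f > 0], because neither
    vanishes there and both are positive near 0; so [|g'| < |h'|] and the condition
    on the quotient become inequalities between real power series with nonnegative
    coefficients, and one lets [r -> 1]. The univalence and sense-preservation of the
    combination have to come from the first family: in general the multipliers are not
    bounded below, so the second family does not imply them. *)

(** The sum of the [t j * f j] is not built as a limit. The combined coefficients come first, [F] is
    the harmonic function they determine, and an exchange of summations identifies it with that sum;
    the exchange has a common majorant because the first family of inequalities forces every
    coefficient to be at most [1]. Strictness of the full sums is lost as [r] tends to 1. Strictness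
    at index 1 is what remains, and it is enough: inside the disc the weights [r ^ k] turn it back
    into a strict inequality for the whole sum. Among the factors of [C_k(m)] only the Pochhammer
    symbol depends on [m]. The other Gamma quotients are common to [M] and [N], so for [N <= M] it
    suffices that they are nonnegative. *)

Local Notation cseries := (is_series (K := C_AbsRing) (V := C_NormedModule)).
Local Notation csum := (sum_n (G := C_AbelianMonoid)).

(** * The Gamma function at the integers and the multipliers *)

(** Lets the improper integral be studied on ordered positive bounds only; there [Rpower t (INR n)]
    agrees with [t ^ n], which fails for [t <= 0]. *)
Lemma at_right_0_infty_ordered (a : R) :
  filter_prod (at_right 0) (Rbar_locally p_infty)
    (fun ab => 0 < fst ab /\ a < snd ab /\ fst ab <= snd ab).
Proof.
  apply Filter_prod with (fun x => 0 < x < 1) (fun x => Rmax a 1 < x).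
  - exists (mkposreal 1 Rlt_0_1). intros y Hy Hy0.
    split; [exact Hy0|].
    unfold ball in Hy; simpl in Hy; unfold AbsRing_ball in Hy; simpl in Hy.
    unfold abs, minus, plus, opp in Hy; simpl in Hy.
    apply Rabs_def2 in Hy; lra.
  - exists (Rmax a 1). intros; assumption.
  - intros x y Hx Hy; simpl.
    generalize (Rmax_l a 1) (Rmax_r a 1); lra.
Qed.

(* If the improper integral does not exist, Coquelicot's [iota] over the empty predicate returns [0]. *)
Lemma Gamma_ge_0 (x : R) : 0 <= Gamma x.
Proof.
  unfold Gamma.
  set (g := fun t => _).
  destruct (classic (ex_RInt_gen g (at_right 0) (Rbar_locally p_infty))) as [He|He].
  - assert (Hi : is_RInt_gen g (at_right 0) (Rbar_locally p_infty)
                  (RInt_gen g (at_right 0) (Rbar_locally p_infty))).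
    { apply (RInt_gen_correct (V := R_CompleteNormedModule)); try typeclasses eauto.
      exact He. }
    (* The norm inequality with [g] as its own majorant bounds the norm of the integral by the
       integral itself. *)
    apply Rle_trans with (norm (RInt_gen g (at_right 0) (Rbar_locally p_infty))).
    { apply norm_ge_0. }
    apply (RInt_gen_norm (Fa := at_right 0) (Fb := Rbar_locally p_infty) g g); try exact Hi.
    + generalize (at_right_0_infty_ordered 0). apply filter_imp. tauto.
    + apply filter_forall. intros ab t _.
      unfold g, norm; simpl. unfold abs; simpl. rewrite Rabs_pos_eq. lra.
      apply Rmult_le_pos; [unfold Rpower|]; left; apply exp_pos.
  - unfold RInt_gen, iota, lim; simpl. unfold R_complete_lim.
    (* With no candidate limit the condition on reals is vacuous, so the supremum is [p_infty],
       whose real part is [0]. *)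
    replace (Lub_Rbar _) with p_infty. simpl; lra.
    symmetry. apply is_lub_Rbar_unique. split.
    + intros y _; exact I.
    + intros b Hb. destruct b as [b| |]; simpl; try tauto.
      * specialize (Hb (b + 1)). simpl in Hb.
        assert (b + 1 <= b); [|lra]. apply Hb.
        intros y Hy. destruct He. exists y; exact Hy.
      * apply (Hb 0). intros y Hy. destruct He. exists y; exact Hy.
Qed.

(** Comes from [exp (t / (n + 1)) >= t / (n + 1)] raised to the power [n + 1]; the exponent exceeds
    [n] by one so that a decaying factor [1 / t] is left. *)
Lemma pow_mul_exp_le (n : nat) (t : R) : 0 < t ->
  t ^ n * exp (- t) <= INR (S n) ^ S n / t.
Proof.
  intros Ht.
  assert (Hn : 0 < INR (S n)) by (apply lt_0_INR; lia).
  assert (He : (t / INR (S n)) ^ S n <= exp t).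
  { replace (exp t) with (exp (t / INR (S n)) ^ S n).
    - apply pow_incr. split; [left; now apply Rdiv_lt_0_compat|].
      generalize (exp_ineq1_le (t / INR (S n))). lra.
    - rewrite <- Rpower_pow by apply exp_pos.
      unfold Rpower. rewrite ln_exp. f_equal. field. lra. }
  apply (Rle_div_r _ _ t Ht).
  rewrite exp_Ropp.
  replace (t ^ n * / exp t * t) with (t ^ S n / exp t) by (simpl; field; apply Rgt_not_eq, exp_pos).
  apply (Rle_div_l _ _ (exp t) (exp_pos t)).
  replace t with (INR (S n) * (t / INR (S n))) at 1 by (field; lra).
  rewrite Rpow_mult_distr. apply Rmult_le_compat_l; [|assumption].
  apply pow_le; lra.
Qed.

Lemma pow_mul_exp_lim (n : nat) :
  filterlim (fun t => t ^ n * exp (- t)) (Rbar_locally p_infty) (locally 0).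
Proof.
  apply filterlim_locally. intros eps.
  assert (Hn : 0 < INR (S n)) by (apply lt_0_INR; lia).
  assert (Hc : 0 < INR (S n) ^ S n) by (now apply pow_lt).
  exists (INR (S n) ^ S n / eps). intros t Ht.
  assert (He := cond_pos eps).
  assert (0 < t) by (eapply Rlt_trans; [|apply Ht]; now apply Rdiv_lt_0_compat).
  change (Rabs (t ^ n * exp (- t) + - 0) < eps).
  rewrite Ropp_0, Rplus_0_r, Rabs_pos_eq.
  2: { apply Rmult_le_pos; [apply pow_le; lra | left; apply exp_pos]. }
  eapply Rle_lt_trans; [now apply pow_mul_exp_le|].
  apply (Rlt_div_l _ _ t H). apply (Rlt_div_l _ _ eps He) in Ht. lra.
Qed.

(** Integration by parts unrolled, with constants chosen so that the antiderivative vanishes at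
    infinity. *)
Fixpoint pow_exp_antideriv (n : nat) (t : R) : R :=
  match n with
  | O => - exp (- t)
  | S n' => INR (S n') * pow_exp_antideriv n' t - t ^ S n' * exp (- t)
  end.

Lemma is_derive_pow_exp_antideriv (n : nat) (t : R) :
  is_derive (pow_exp_antideriv n) t (t ^ n * exp (- t)).
Proof.
  induction n as [|n IH].
  - simpl. auto_derive; [trivial|ring].
  - replace (t ^ S n * exp (- t)) with
      (INR (S n) * (t ^ n * exp (- t)) -
       (INR (S n) * t ^ n * exp (- t) + t ^ S n * (- exp (- t)))) by ring.
    apply (is_derive_minus (V := R_NormedModule) (fun t => INR (S n) * pow_exp_antideriv n t)).
    + now apply (is_derive_scal (pow_exp_antideriv n)).
    + auto_derive; [trivial|]. simpl. ring.
Qed.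

Lemma pow_exp_antideriv_0 (n : nat) : pow_exp_antideriv n 0 = - INR (fact n).
Proof.
  induction n as [|n IH].
  - simpl. rewrite Ropp_0, exp_0. reflexivity.
  - cbn [pow_exp_antideriv]. rewrite IH, fact_simpl, mult_INR, pow_i by lia. ring.
Qed.

Lemma pow_exp_antideriv_lim (n : nat) :
  filterlim (pow_exp_antideriv n) (Rbar_locally p_infty) (locally 0).
Proof.
  induction n as [|n IH].
  - apply filterlim_ext with (fun t => - (t ^ 0 * exp (- t))).
    { intros t; simpl; ring. }
    replace 0 with (- 0) at 1 by ring.
    eapply filterlim_comp; [apply (pow_mul_exp_lim 0)|].
    apply (filterlim_opp (V := R_NormedModule) 0).
  - cbn [pow_exp_antideriv].
    replace 0 with (INR (S n) * 0 + - 0) at 1 by ring.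
    apply (filterlim_comp_2 (F := Rbar_locally p_infty) (G := locally (INR (S n) * 0))
             (H := locally (- 0)) (fun t => INR (S n) * pow_exp_antideriv n t)
             (fun t => - (t ^ S n * exp (- t))) Rplus).
    + eapply filterlim_comp; [apply IH|].
      apply (filterlim_scal_r (V := R_NormedModule) (INR (S n)) 0).
    + eapply filterlim_comp; [apply (pow_mul_exp_lim (S n))|].
      apply (filterlim_opp (V := R_NormedModule) 0).
    + apply (filterlim_plus (V := R_NormedModule) (INR (S n) * 0) (- 0)).
Qed.

Lemma is_RInt_gen_pow_exp (n : nat) :
  is_RInt_gen (fun t => t ^ n * exp (- t)) (at_right 0) (Rbar_locally p_infty) (INR (fact n)).
Proof.
  assert (HD : forall t, Derive (pow_exp_antideriv n) t = t ^ n * exp (- t)).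
  { intros t. apply is_derive_unique, is_derive_pow_exp_antideriv. }
  apply (is_RInt_gen_ext (V := R_NormedModule) (Derive (pow_exp_antideriv n))).
  { apply filter_forall. intros ab t _. apply HD. }
  replace (INR (fact n)) with (0 - - INR (fact n)) by ring.
  apply is_RInt_gen_Derive; try typeclasses eauto.
  - apply filter_forall. intros ab t _. eexists. apply is_derive_pow_exp_antideriv.
  - apply filter_forall. intros ab t _.
    apply continuous_ext with (fun t => t ^ n * exp (- t)); [now intros; rewrite HD|].
    apply (ex_derive_continuous (V := R_NormedModule)). auto_derive; trivial.
  - rewrite <- pow_exp_antideriv_0.
    eapply filterlim_filter_le_1; [apply filter_le_within|].
    apply (ex_derive_continuous (V := R_NormedModule)). eexists.
    apply is_derive_pow_exp_antideriv.
  - apply pow_exp_antideriv_lim.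
Qed.

Lemma Gamma_nat (n : nat) : Gamma (INR n + 1) = INR (fact n).
Proof.
  unfold Gamma. apply is_RInt_gen_unique; try typeclasses eauto.
  apply (is_RInt_gen_ext (V := R_NormedModule) (fun t => t ^ n * exp (- t)));
    [|apply is_RInt_gen_pow_exp].
  generalize (at_right_0_infty_ordered 0). apply filter_imp.
  intros [a b] [Ha [Hb Hab]] t Ht; simpl in *.
  rewrite Rmin_left in Ht by assumption.
  replace (INR n + 1 - 1) with (INR n) by ring.
  rewrite Rpower_pow by lra. reflexivity.
Qed.

(** Includes [y = 0], where the quotient is [0]; hence nonnegative Gamma values suffice in [Ck_ge_0]
    and [Ck_mono]. *)
Lemma Rdiv_ge_0 (x y : R) : 0 <= x -> 0 <= y -> 0 <= x / y.
Proof.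
  intros Hx Hy. destruct (Req_dec y 0) as [->|Hy'].
  - unfold Rdiv. rewrite Rinv_0. lra.
  - apply Rdiv_le_0_compat; lra.
Qed.

Lemma Ck_ge_0 (alpha beta gamma delta p q : R) (m k : nat) :
  0 <= Ck alpha beta gamma delta p q m k.
Proof.
  destruct k as [|[|k]]; simpl Ck; try lra.
  apply Rmult_le_pos; repeat apply Rdiv_ge_0; repeat apply Rmult_le_pos;
    try apply Gamma_ge_0; try apply pos_INR.
Qed.

Lemma poch_nat (m k : nat) : poch (INR m + 1) k = INR (fact (m + k)) / INR (fact m).
Proof.
  unfold poch. replace (INR m + 1 + INR k) with (INR (m + k) + 1).
  now rewrite !Gamma_nat. rewrite plus_INR; ring.
Qed.

(** Passing from [m] to [m + 1] multiplies the symbol by [(m + 1 + k) / (m + 1) >= 1]. *)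
Lemma poch_nat_mono (n m k : nat) : (n <= m)%nat -> poch (INR n + 1) k <= poch (INR m + 1) k.
Proof.
  induction 1 as [|m Hm IH]; [lra|].
  apply Rle_trans with (1 := IH). rewrite !poch_nat.
  assert (Hf := INR_fact_lt_0 m). assert (Hf' := INR_fact_lt_0 (m + k)).
  simpl Nat.add. rewrite !fact_simpl, !mult_INR.
  assert (0 < INR (S m)) by (apply lt_0_INR; lia).
  assert (INR (S m) <= INR (S (m + k))) by (apply le_INR; lia).
  replace (INR (fact (m + k)) / INR (fact m))
    with (INR (S m) * INR (fact (m + k)) / (INR (S m) * INR (fact m))) by (field; lra).
  apply Rmult_le_compat_r.
  - left; apply Rinv_0_lt_compat; nra.
  - nra.
Qed.

Lemma Ck_mono (alpha beta gamma delta p q : R) (n m k : nat) : (n <= m)%nat ->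
  Ck alpha beta gamma delta p q n k <= Ck alpha beta gamma delta p q m k.
Proof.
  intros Hnm.
  destruct k as [|[|k]]; simpl Ck; try lra.
  apply Rmult_le_compat_r.
  - repeat apply Rdiv_ge_0; repeat apply Rmult_le_pos; apply Gamma_ge_0.
  - apply Rmult_le_compat_r.
    + left; apply Rinv_0_lt_compat, (INR_fact_lt_0 (S k)).
    + now apply poch_nat_mono.
Qed.

(** * Complex series *)

Lemma csum_S (u : nat -> C) n : csum u (S n) = (csum u n + u (S n))%C.
Proof. apply (sum_Sn (G := C_AbelianMonoid)). Qed.

Lemma csum_O (u : nat -> C) : csum u 0 = u 0%nat.
Proof. apply (sum_O (G := C_AbelianMonoid)). Qed.

(** Reduces complex convergence to a real sequence, where squeezing and comparison of limits are
    available. *)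
Lemma cseries_iff (u : nat -> C) (l : C) :
  cseries u l <-> is_lim_seq (fun n => Cmod (csum u n - l)) 0.
Proof.
  split; intros H.
  - replace 0 with (norm (minus (l : C_NormedModule) l)).
    2: { rewrite minus_eq_zero. apply (norm_zero (V := C_NormedModule)). }
    eapply (filterlim_comp _ _ _ (fun n => minus (csum u n : C_NormedModule) l) norm);
      [|apply (filterlim_norm (V := C_NormedModule))].
    apply (filterlim_comp_2 (F := eventually) (G := locally (l : C_NormedModule))
             (H := locally (opp (l : C_NormedModule))) (csum u) (fun _ => opp (l : C_NormedModule)) plus).
    + exact H.
    + apply filterlim_const.
    + apply (filterlim_plus (V := C_NormedModule)).
  - unfold is_series.
    assert (H0 : filterlim (fun n => minus (csum u n : C_NormedModule) l) eventually (locally (zero : C_NormedModule))).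
    { apply (filterlim_norm_zero (V := C_NormedModule)). exact H. }
    apply filterlim_ext with (fun n => plus (minus (csum u n : C_NormedModule) l) l).
    { intros n. unfold minus. rewrite <- plus_assoc, plus_opp_l. apply plus_zero_r. }
    generalize (filterlim_comp_2 (F := eventually) (G := locally (zero : C_NormedModule))
             (H := locally (l : C_NormedModule)) (fun n => minus (csum u n : C_NormedModule) l)
             (fun _ => l : C_NormedModule) plus H0 (filterlim_const l)
             (filterlim_plus (V := C_NormedModule) _ _)).
    now rewrite plus_zero_l.
Qed.

Lemma cseries_ext (u v : nat -> C) (l : C) : (forall k, u k = v k) -> cseries u l -> cseries v l.
Proof. apply (is_series_ext (V := C_NormedModule)). Qed.

Lemma cseries_plus (u v : nat -> C) (l l' : C) :
  cseries u l -> cseries v l' -> cseries (fun k => u k + v k)%C (l + l')%C.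
Proof. apply (is_series_plus (V := C_NormedModule)). Qed.

Lemma cseries_scal (c : C) (u : nat -> C) (l : C) :
  cseries u l -> cseries (fun k => c * u k)%C (c * l)%C.
Proof. apply (is_series_scal (V := C_NormedModule)). Qed.

Lemma cseries_minus (u v : nat -> C) (l l' : C) :
  cseries u l -> cseries v l' -> cseries (fun k => u k - v k)%C (l - l')%C.
Proof. apply (is_series_minus (V := C_NormedModule)). Qed.

Lemma cseries_incr_1 (u : nat -> C) (l : C) :
  u 0%nat = 0 -> cseries u l -> cseries (fun k => u (S k)) l.
Proof.
  intros H0 H. apply (is_series_incr_1 (V := C_NormedModule)). rewrite H0.
  replace (plus (l : C_NormedModule) (RtoC 0)) with l; [exact H|].
  symmetry. apply (plus_zero_r (G := C_NormedModule)).
Qed.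

Lemma cseries_decr_1 (u : nat -> C) (l : C) :
  u 0%nat = 0 -> cseries (fun k => u (S k)) l -> cseries u l.
Proof.
  intros H0 H. apply (is_series_decr_1 (V := C_NormedModule)). rewrite H0.
  replace (plus (l : C_NormedModule) (opp (RtoC 0 : C_NormedModule))) with l; [exact H|].
  change (l = l - 0)%C. ring.
Qed.

Lemma cseries_unique (u : nat -> C) (l l' : C) : cseries u l -> cseries u l' -> l = l'.
Proof. apply (filterlim_locally_unique (V := C_NormedModule)). Qed.

Lemma csum_Re (u : nat -> C) n : Re (csum u n) = sum_n (fun k => Re (u k)) n.
Proof.
  induction n as [|n IH]; [now rewrite csum_O, sum_O|].
  now rewrite csum_S, sum_Sn, <- IH.
Qed.

Lemma csum_conj (u : nat -> C) n : csum (fun k => Cconj (u k)) n = Cconj (csum u n).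
Proof.
  induction n as [|n IH]; [now rewrite !csum_O|].
  rewrite !csum_S, IH. symmetry; apply Cplus_conj.
Qed.

Lemma cseries_conj (u : nat -> C) (l : C) : cseries u l -> cseries (fun k => Cconj (u k)) (Cconj l).
Proof.
  rewrite !cseries_iff. apply is_lim_seq_ext. intros n.
  now rewrite csum_conj, <- Cminus_conj, Cmod_conj.
Qed.

Lemma cseries_Re (u : nat -> C) (l : C) : cseries u l -> is_series (fun k => Re (u k)) (Re l).
Proof.
  rewrite cseries_iff. intros H.
  change (is_lim_seq (sum_n (fun k => Re (u k))) (Re l)).
  apply (is_lim_seq_ext (fun n => Re (csum u n))); [apply csum_Re|].
  apply is_lim_seq_le_le with (fun n => Re l - Cmod (csum u n - l)) (fun n => Re l + Cmod (csum u n - l)).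
  - intros n. generalize (Rmax_Cmod (csum u n - l)%C) (Rmax_l (Rabs (fst (csum u n - l)%C)) (Rabs (snd (csum u n - l)%C))).
    change (fst (csum u n - l)%C) with (Re (csum u n) - Re l).
    intros H1 H2. assert (H3 : Rabs (Re (csum u n) - Re l) <= Cmod (csum u n - l)) by lra.
    apply Rabs_le_between in H3. lra.
  - replace (Finite (Re l)) with (Finite (Re l - 0)) by (f_equal; ring).
    apply is_lim_seq_minus'; [apply is_lim_seq_const|exact H].
  - replace (Finite (Re l)) with (Finite (Re l + 0)) by (f_equal; ring).
    apply is_lim_seq_plus'; [apply is_lim_seq_const|exact H].
Qed.

Lemma Cmod_csum_lim (u : nat -> C) (l : C) :
  cseries u l -> is_lim_seq (fun n => Cmod (csum u n)) (Cmod l).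
Proof.
  intros H. eapply (filterlim_comp _ _ _ (csum u) Cmod); [exact H|].
  apply (filterlim_norm (V := C_NormedModule)).
Qed.

Lemma Cmod_csum_le (u : nat -> C) n : Cmod (csum u n) <= sum_n (fun k => Cmod (u k)) n.
Proof. apply (norm_sum_n_m (V := C_NormedModule)). Qed.

(** Bounds the two sums jointly: the class only controls [a] and [b] together, so separate bounds
    would lose a factor. *)
Lemma cseries_Cmod_le2 (u v : nat -> C) (l l' : C) (M : R) :
  cseries u l -> cseries v l' ->
  (forall K, sum_n (fun k => Cmod (u k) + Cmod (v k)) K <= M) ->
  Cmod l + Cmod l' <= M.
Proof.
  intros Hu Hv HM.
  apply (is_lim_seq_le (fun n => Cmod (csum u n) + Cmod (csum v n)) (fun _ => M)
           (Cmod l + Cmod l') M).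
  - intros n. apply Rle_trans with (2 := HM n).
    change (sum_n (fun k => Cmod (u k) + Cmod (v k)) n)
      with (sum_n (fun k => plus (Cmod (u k)) (Cmod (v k))) n).
    rewrite sum_n_plus.
    apply Rplus_le_compat; apply Cmod_csum_le.
  - apply is_lim_seq_plus'; now apply Cmod_csum_lim.
  - apply is_lim_seq_const.
Qed.

Lemma cseries_Cmod_le (u : nat -> C) (l : C) (M : R) :
  cseries u l -> (forall K, sum_n (fun k => Cmod (u k)) K <= M) -> Cmod l <= M.
Proof.
  intros Hu HM.
  apply (is_lim_seq_le (fun n => Cmod (csum u n)) (fun _ => M) (Cmod l) M).
  - intros n. apply Rle_trans with (2 := HM n). apply Cmod_csum_le.
  - now apply Cmod_csum_lim.
  - apply is_lim_seq_const.
Qed.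

Lemma ex_cseries_le (u : nat -> C) (rho : nat -> R) :
  (forall k, Cmod (u k) <= rho k) -> ex_series rho -> exists l, cseries u l.
Proof. apply (ex_series_le (V := C_CompleteNormedModule)). Qed.

Lemma sum_n_Rle (u v : nat -> R) n : (forall k, u k <= v k) -> sum_n u n <= sum_n v n.
Proof. intros H. apply sum_n_m_le, H. Qed.

Lemma sum_n_le_series (u : nat -> R) (l : R) n :
  (forall k, 0 <= u k) -> is_series u l -> sum_n u n <= l.
Proof.
  intros Hu Hl. apply (is_lim_seq_incr_compare (sum_n u)); [exact Hl|].
  intros k. rewrite sum_Sn. change (sum_n u k <= sum_n u k + u (S k)). generalize (Hu (S k)); lra.
Qed.

(* [t_j >= 0] of total mass 1, and the rows [u j] have the common majorant [rho]: by the
   triangle inequality the exchange error after [J] rows is at most [(1 - t_0 - ... - t_J) sum rho]. *)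
Lemma cseries_convex_exchange (t : nat -> R) (u : nat -> nat -> C) (s : nat -> C)
  (U : nat -> C) (l : C) (rho : nat -> R) :
  (forall j, 0 <= t j) -> is_series t 1 ->
  (forall j k, Cmod (u j k) <= rho k) -> ex_series rho ->
  (forall j, cseries (u j) (s j)) ->
  (forall k, cseries (fun j => t j * u j k)%C (U k)) ->
  cseries U l ->
  cseries (fun j => t j * s j)%C l.
Proof.
  intros Ht Ht1 Hu [rr Hrho] Hs HU Hl.
  assert (Hrho0 : forall k, 0 <= rho k) by (intros k; apply Rle_trans with (2 := Hu 0%nat k), Cmod_ge_0).
  (* The rows from [J + 1] to [n] have weight [sum_n t n - sum_n t J], which gives the bound for
     partial sums; then [n] tends to infinity. *)
  assert (Hrow : forall J k, Cmod (csum (fun j => t j * u j k)%C J - U k) <= (1 - sum_n t J) * rho k).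
  { intros J k.
    assert (Hlim : is_lim_seq (fun n => Cmod (csum (fun j => t j * u j k)%C n - U k)) 0)
      by (apply cseries_iff, HU).
    assert (Hlt : is_lim_seq (fun n => (sum_n t n - sum_n t J) * rho k +
        Cmod (csum (fun j => t j * u j k)%C n - U k)) ((1 - sum_n t J) * rho k + 0)).
    { apply is_lim_seq_plus'; [|exact Hlim].
      apply is_lim_seq_mult'; [|apply is_lim_seq_const].
      apply is_lim_seq_minus'; [exact Ht1|apply is_lim_seq_const]. }
    rewrite Rplus_0_r in Hlt.
    apply (is_lim_seq_le_loc (fun _ => Cmod (csum (fun j => t j * u j k)%C J - U k)) _
             (Cmod (csum (fun j => t j * u j k)%C J - U k)) ((1 - sum_n t J) * rho k)) with (3 := Hlt).
    2: apply is_lim_seq_const.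
    exists J. intros n Hn.
    assert (Hd : Cmod (csum (fun j => t j * u j k)%C n - csum (fun j => t j * u j k)%C J)
                 <= (sum_n t n - sum_n t J) * rho k).
    { induction Hn as [|n Hn IH].
      - replace (_ - _)%C with (RtoC 0) by ring. rewrite Cmod_0. lra.
      - rewrite csum_S, sum_Sn.
        change (plus (sum_n t n) (t (S n))) with (sum_n t n + t (S n)).
        replace (csum (fun j => t j * u j k)%C n + t (S n) * u (S n) k - csum (fun j => t j * u j k)%C J)%C
          with ((csum (fun j => t j * u j k)%C n - csum (fun j => t j * u j k)%C J) + t (S n) * u (S n) k)%C
          by ring.
        eapply Rle_trans; [apply Cmod_triangle|].
        rewrite Cmod_mult, Cmod_R, (Rabs_pos_eq (t (S n))) by apply Ht.
        assert (t (S n) * Cmod (u (S n) k) <= t (S n) * rho k) by (apply Rmult_le_compat_l; auto).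
        nra. }
    replace (csum (fun j => t j * u j k)%C J - U k)%C with
      (- (csum (fun j => t j * u j k)%C n - csum (fun j => t j * u j k)%C J)
        + (csum (fun j => t j * u j k)%C n - U k))%C by ring.
    eapply Rle_trans; [apply Cmod_triangle|]. rewrite Cmod_opp. lra. }
  assert (Hpart : forall J, cseries (fun k => csum (fun j => t j * u j k)%C J) (csum (fun j => t j * s j)%C J)).
  { induction J as [|J IH].
    - rewrite csum_O. apply cseries_ext with (fun k => t 0%nat * u 0%nat k)%C.
      { intros k. now rewrite csum_O. }
      apply cseries_scal, Hs.
    - rewrite csum_S. apply cseries_ext with
        (fun k => csum (fun j => t j * u j k)%C J + t (S J) * u (S J) k)%C.
      { intros k. now rewrite csum_S. }
      apply cseries_plus; [exact IH|apply cseries_scal, Hs]. }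
  assert (HT : forall J, sum_n t J <= 1) by (intros; now apply sum_n_le_series).
  apply cseries_iff.
  apply is_lim_seq_le_le with (fun _ => 0) (fun J => (1 - sum_n t J) * rr).
  - intros J. split; [apply Cmod_ge_0|].
    apply cseries_Cmod_le with (1 := cseries_minus _ _ _ _ (Hpart J) Hl).
    intros K. eapply Rle_trans; [apply sum_n_Rle, Hrow|].
    rewrite (sum_n_mult_l (K := R_Ring) (1 - sum_n t J) rho).
    apply Rmult_le_compat_l; [generalize (HT J); lra|].
    now apply sum_n_le_series.
  - apply is_lim_seq_const.
  - replace 0 with ((1 - 1) * rr) by ring.
    apply is_lim_seq_mult'; [|apply is_lim_seq_const].
    apply is_lim_seq_minus'; [apply is_lim_seq_const|exact Ht1].
Qed.

(** * Power series *)

Lemma cpseries_cseries (c : nat -> C) (z l : C) :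
  cpseries c z l <-> cseries (fun k => z ^ k * c k)%C l.
Proof. reflexivity. Qed.

Lemma CV_radius_ge_1 (c : nat -> R) :
  (forall r, 0 < r < 1 -> exists M, forall n, Rabs (c n * r ^ n) <= M) -> Rbar_le 1 (CV_radius c).
Proof.
  intros H. destruct (CV_radius_bounded c) as [Hub _].
  destruct (Rbar_le_lt_dec 1 (CV_radius c)) as [Hle|Hlt]; [exact Hle|exfalso].
  generalize (CV_radius_ge_0 c).
  destruct (CV_radius c) as [x| |] eqn:Hx; simpl in *; try tauto.
  (* If the radius were [x < 1], the terms would be bounded at the midpoint of [x] and 1, beyond the
     radius. *)
  intros Hx0. specialize (Hub ((1 + x) / 2)). simpl in Hub.
  assert ((1 + x) / 2 <= x); [|lra]. apply Hub, H. lra.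
Qed.

Lemma ex_series_bounded (u : nat -> R) : ex_series u -> exists M, forall n, Rabs (u n) <= M.
Proof.
  intros H. apply ex_series_lim_0 in H.
  destruct (filterlim_bounded u) as [M HM].
  - exists 0. exact H.
  - exists M. exact HM.
Qed.

Lemma PSeries_pos (c : nat -> R) :
  (forall r, 0 < r < 1 -> ex_pseries c r) -> 0 < c 0%nat ->
  (forall r, 0 < r < 1 -> PSeries c r <> 0) ->
  forall r, 0 < r < 1 -> 0 < PSeries c r.
Proof.
  intros Hex H0 Hnz r Hr.
  assert (HR : Rbar_le 1 (CV_radius c)).
  { apply CV_radius_ge_1. intros x Hx. apply ex_series_bounded.
    destruct (Hex x Hx) as [l Hl]. exists l. now apply is_pseries_R. }
  destruct (Rlt_or_le 0 (PSeries c r)) as [Hp|Hn]; [exact Hp|exfalso].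
  (* The sign is reversed because [IVT_interv] wants a function going from negative to positive. The
     zero found is not at 0, where the value is [c 0 > 0]. *)
  destruct (IVT_interv (fun x => - PSeries c x) 0 r) as [x [Hx Hx0]].
  - intros x Hx. apply continuity_pt_opp, PSeries_continuity.
    apply Rbar_lt_le_trans with 1; [|exact HR]. simpl. rewrite Rabs_pos_eq; lra.
  - lra.
  - rewrite PSeries_0. lra.
  - generalize (Hnz r Hr). lra.
  - apply (Hnz x); [|lra]. split; [|lra].
    destruct (Req_dec x 0) as [->|]; [|lra]. rewrite PSeries_0 in Hx0. lra.
Qed.

(** The sum is real because conjugation fixes every term and sums are unique. *)
Lemma cpseries_real (c : nat -> R) (r : R) (l : C) :
  cpseries (fun k => RtoC (c k)) (RtoC r) l -> is_pseries c r (Re l) /\ l = RtoC (Re l).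
Proof.
  intros H. rewrite cpseries_cseries in H.
  assert (H' : cseries (fun k => RtoC (r ^ k * c k)) l).
  { apply (cseries_ext _ _ _ (fun k => eq_sym (eq_trans (RtoC_mult _ _) (f_equal (fun x => Cmult x _) (RtoC_pow r k)))) H). }
  split.
  - apply is_pseries_R. generalize (cseries_Re _ _ H').
    apply is_series_ext. intros k. simpl. ring.
  - assert (Hc : Cconj l = l).
    { apply (cseries_unique (fun k => RtoC (r ^ k * c k))); [|exact H'].
      apply cseries_ext with (fun k => Cconj (RtoC (r ^ k * c k))); [|now apply cseries_conj].
      intros k. unfold Cconj, RtoC; simpl. now rewrite Ropp_0. }
    destruct l as [x y]. unfold Cconj in Hc; simpl in Hc. injection Hc; intros Hy.
    unfold RtoC; simpl. f_equal. lra.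
Qed.

Lemma ex_cpseries_bounded (c : nat -> C) (M : R) (z : C) :
  (forall k, Cmod (c k) <= M) -> inU z -> exists l, cpseries c z l.
Proof.
  intros HM Hz. unfold inU in Hz.
  apply ex_cseries_le with (fun k => Cmod z ^ k * M).
  - intros k. change (Cmod (z ^ k * c k) <= Cmod z ^ k * M).
    rewrite Cmod_mult, Cmod_pow. apply Rmult_le_compat_l; [|apply HM].
    apply pow_le, Cmod_ge_0.
  - exists (/ (1 - Cmod z) * M). apply is_series_scal_r, is_series_geom.
    rewrite Rabs_pos_eq; [exact Hz|apply Cmod_ge_0].
Qed.

Lemma Cmod_pow_diff_le (z w : C) (rho : R) (k : nat) :
  Cmod z <= rho -> Cmod w <= rho ->
  Cmod (w ^ S k - z ^ S k) <= INR (S k) * rho ^ k * Cmod (w - z).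
Proof.
  intros Hz Hw. assert (0 <= rho) by (apply Rle_trans with (2 := Hz), Cmod_ge_0).
  induction k as [|k IH].
  - rewrite !Cpow_1_r. simpl. lra.
  - replace (w ^ S (S k) - z ^ S (S k))%C
      with (w * (w ^ S k - z ^ S k) + z ^ S k * (w - z))%C by (rewrite !(Cpow_S _ (S k)); ring).
    eapply Rle_trans; [apply Cmod_triangle|]. rewrite !Cmod_mult, Cmod_pow, (S_INR (S k)).
    assert (Cmod z ^ S k <= rho ^ S k) by (apply pow_incr; split; [apply Cmod_ge_0|exact Hz]).
    assert (Cmod w * Cmod (w ^ S k - z ^ S k) <= rho * (INR (S k) * rho ^ k * Cmod (w - z))).
    { apply Rmult_le_compat; auto using Cmod_ge_0. }
    generalize (Cmod_ge_0 (w - z)%C). intros.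
    assert (Cmod z ^ S k * Cmod (w - z) <= rho ^ S k * Cmod (w - z)) by (now apply Rmult_le_compat_r).
    simpl pow in *. lra.
Qed.

(** The constant is twice the sharp one, so that it matches the coefficients of the formal second
    derivative [PS_derive (PS_derive A)] in [cpseries_derive]. *)
Lemma Cmod_pow_taylor_le (z w : C) (rho : R) (k : nat) :
  Cmod z <= rho -> Cmod w <= rho ->
  Cmod (w ^ S (S k) - z ^ S (S k) - INR (S (S k)) * z ^ S k * (w - z))
    <= INR (S (S k)) * INR (S k) * rho ^ k * Cmod (w - z) ^ 2.
Proof.
  intros Hz Hw. assert (Hr : 0 <= rho) by (apply Rle_trans with (2 := Hz), Cmod_ge_0).
  induction k as [|k IH].
  - replace (w ^ 2 - z ^ 2 - INR 2 * z ^ 1 * (w - z))%C with ((w - z) ^ 2)%C.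
    2: { change (INR 2) with (1 + 1). rewrite RtoC_plus. simpl. ring. }
    rewrite Cmod_pow. simpl. generalize (pow2_ge_0 (Cmod (w - z))). simpl. nra.
  - set (E := (w ^ S (S k) - z ^ S (S k) - INR (S (S k)) * z ^ S k * (w - z))%C) in *.
    replace (w ^ S (S (S k)) - z ^ S (S (S k)) - INR (S (S (S k))) * z ^ S (S k) * (w - z))%C
      with (w * E + INR (S (S k)) * z ^ S k * (w - z) ^ 2)%C.
    2: { unfold E. rewrite (S_INR (S (S k))), RtoC_plus. simpl. ring. }
    eapply Rle_trans; [apply Cmod_triangle|]. rewrite !Cmod_mult, !Cmod_pow, Cmod_R.
    rewrite Rabs_pos_eq by apply pos_INR.
    assert (Hp : Cmod z ^ S k <= rho ^ S k) by (apply pow_incr; split; [apply Cmod_ge_0|exact Hz]).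
    assert (H1 : Cmod w * Cmod E <= rho * (INR (S (S k)) * INR (S k) * rho ^ k * Cmod (w - z) ^ 2)).
    { apply Rmult_le_compat; auto using Cmod_ge_0. }
    assert (H2 : INR (S (S k)) * Cmod z ^ S k * Cmod (w - z) ^ 2
            <= INR (S (S k)) * rho ^ S k * Cmod (w - z) ^ 2).
    { apply Rmult_le_compat_r; [apply pow2_ge_0|]. apply Rmult_le_compat_l; [apply pos_INR|exact Hp]. }
    assert (H3 : 0 <= INR (S (S k)) * (rho ^ S k * Cmod (w - z) ^ 2)).
    { apply Rmult_le_pos; [apply pos_INR|]. apply Rmult_le_pos; [now apply pow_le|apply pow2_ge_0]. }
    rewrite (S_INR (S (S k))), (S_INR (S k)) in *. simpl pow in *. nra.
Qed.

Lemma is_derive_quadratic (F : C -> C) (z l : C) (d K : R) :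
  0 < d -> 0 <= K ->
  (forall w, Cmod (w - z) < d -> Cmod (F w - F z - (w - z) * l) <= K * Cmod (w - z) ^ 2) ->
  cderive F z l.
Proof.
  intros Hd HK H. split.
  - apply (is_linear_scal_l (V := C_NormedModule) l).
  - intros x Hx. apply (is_filter_lim_locally_unique (V := AbsRing_NormedModule C_AbsRing)) in Hx.
    subst x. intros eps.
    assert (He := cond_pos eps).
    (* [K + 1] instead of [K] keeps the denominator positive when [K = 0]. *)
    assert (Hd' : 0 < Rmin d (eps / (K + 1))).
    { apply Rmin_pos; [exact Hd|]. apply Rdiv_lt_0_compat; lra. }
    exists (mkposreal _ Hd'). intros w Hw.
    change (Cmod (w - z) < Rmin d (eps / (K + 1))) in Hw.
    change (Cmod (F w - F z - (w - z) * l) <= eps * Cmod (w - z)).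
    eapply Rle_trans; [apply H|].
    + apply Rlt_le_trans with (1 := Hw), Rmin_l.
    + assert (Hw2 : Cmod (w - z) < eps / (K + 1)) by (apply Rlt_le_trans with (1 := Hw), Rmin_r).
      apply (Rlt_div_r _ _ (K + 1)) in Hw2; [|lra].
      generalize (Cmod_ge_0 (w - z)%C). intros Hp. simpl.
      assert (K * Cmod (w - z) <= eps) by nra. nra.
Qed.

(** Each term is a difference of two partial sums, and these are bounded because they converge;
    whence [M + M]. *)
Lemma cpseries_terms_bounded (c : nat -> C) (r : R) (l : C) :
  0 <= r -> cpseries c (RtoC r) l -> exists M, forall k, Rabs (Cmod (c k) * r ^ k) <= M.
Proof.
  intros Hr H. rewrite cpseries_cseries in H.
  destruct (filterlim_bounded (V := C_NormedModule) (csum (fun k => r ^ k * c k)%C)) as [M HM].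
  { exists l. exact H. }
  exists (M + M). intros k.
  assert (Hk : Cmod (r ^ k * c k) <= M + M).
  { destruct k as [|k].
    - specialize (HM 0%nat). rewrite csum_O in HM.
      change (Cmod (r ^ 0 * c 0%nat) <= M) in HM. generalize (Cmod_ge_0 (r ^ 0 * c 0%nat)%C). lra.
    - replace (r ^ S k * c (S k))%C with
        (csum (fun k => r ^ k * c k)%C (S k) - csum (fun k => r ^ k * c k)%C k)%C
        by (rewrite csum_S; ring).
      eapply Rle_trans; [apply Cmod_triangle|]. rewrite Cmod_opp.
      apply Rplus_le_compat; apply HM. }
  rewrite Cmod_mult, Cmod_pow, Cmod_R, (Rabs_pos_eq r Hr) in Hk.
  rewrite Rabs_pos_eq; [lra|]. apply Rmult_le_pos; [apply Cmod_ge_0|now apply pow_le].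
Qed.

(** The series of moduli also has radius at least 1, so its formal derivatives converge and majorize
    both the differentiated series and the second-order Taylor remainder. *)
Lemma cpseries_derive (c : nat -> C) (F : C -> C) :
  (forall z, inU z -> cpseries c z (F z)) ->
  forall z, inU z -> exists l,
    cpseries (fun k => INR (S k) * c (S k))%C z l /\ cderive F z l.
Proof.
  intros HF z Hz. unfold inU in *.
  set (A := fun k => Cmod (c k)).
  assert (HR : Rbar_le 1 (CV_radius A)).
  { apply CV_radius_ge_1. intros r Hr. apply cpseries_terms_bounded with (F (RtoC r)); [lra|].
    apply HF. rewrite Cmod_R, Rabs_pos_eq; lra. }
  assert (Hz0 := Cmod_ge_0 z).
  (* Midpoint of [|z|] and 1: every [w] within [rho - |z|] of [z] satisfies [|w| <= rho < 1]. *)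
  set (rho := (1 + Cmod z) / 2).
  assert (Hrho : 0 <= rho < 1) by (unfold rho; lra).
  assert (HA : forall r, 0 <= r < 1 -> Rbar_lt (Rabs r) (CV_radius A)).
  { intros r Hr. apply Rbar_lt_le_trans with 1; [|exact HR]. simpl. rewrite Rabs_pos_eq; lra. }
  destruct (ex_pseries_derive A (Cmod z)) as [m1 Hm1]; [apply HA; lra|].
  apply is_pseries_R in Hm1.
  destruct (ex_pseries_derive (PS_derive A) rho) as [K HK]; [rewrite CV_radius_derive; now apply HA|].
  apply is_pseries_R in HK.
  destruct (ex_cseries_le (fun k => z ^ k * (INR (S k) * c (S k)))%C
              (fun k => PS_derive A k * Cmod z ^ k)) as [l Hl].
  { intros k. rewrite !Cmod_mult, Cmod_pow, Cmod_R, Rabs_pos_eq by apply pos_INR.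
    unfold PS_derive, A. lra. }
  { now exists m1. }
  exists l. split; [exact Hl|].
  assert (Hterm : forall k, 0 <= PS_derive (PS_derive A) k * rho ^ k).
  { intros k. unfold PS_derive, A. repeat apply Rmult_le_pos; try apply pos_INR; try apply Cmod_ge_0.
    apply pow_le; lra. }
  apply is_derive_quadratic with (rho - Cmod z) K.
  - unfold rho; lra.
  - apply Rle_trans with (2 := sum_n_le_series _ _ 0 Hterm HK). rewrite sum_O. apply Hterm.
  - intros w Hw.
    assert (Hwr : Cmod w <= rho).
    { replace w with ((w - z) + z)%C by ring. eapply Rle_trans; [apply Cmod_triangle|lra]. }
    (* The derivative series is shifted by a leading zero to align with the indices of [F]. The
       remainder then vanishes at indices 0 and 1, which are dropped. *)
    assert (HS := cseries_minus _ _ _ _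
       (cseries_minus _ _ _ _ (proj1 (cpseries_cseries _ _ _) (HF w ltac:(lra)))
                              (proj1 (cpseries_cseries _ _ _) (HF z Hz)))
       (cseries_decr_1 (fun k => match k with O => RtoC 0 | S k =>
           (w - z) * (z ^ k * (INR (S k) * c (S k))) end)%C _ eq_refl (cseries_scal (w - z)%C _ _ Hl))).
    apply cseries_incr_1 in HS; [|simpl; ring].
    apply cseries_incr_1 in HS; [|simpl; ring].
    apply cseries_Cmod_le with (1 := HS). intros n.
    apply Rle_trans with (sum_n (fun k => PS_derive (PS_derive A) k * rho ^ k * Cmod (w - z) ^ 2) n).
    + apply sum_n_Rle. intros k.
      replace (_ - _)%C with (c (S (S k)) * (w ^ S (S k) - z ^ S (S k) - INR (S (S k)) * z ^ S k * (w - z)))%C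
        by ring.
      rewrite Cmod_mult. unfold PS_derive, A.
      generalize (Cmod_pow_taylor_le z w rho k ltac:(unfold rho; lra) Hwr). intros HT.
      apply Rmult_le_compat_l with (1 := Cmod_ge_0 (c (S (S k)))) in HT.
      eapply Rle_trans; [exact HT|]. apply Req_le. ring.
    + rewrite (sum_n_mult_r (K := R_Ring) (Cmod (w - z) ^ 2)).
      apply Rmult_le_compat_r; [apply pow2_ge_0|].
      now apply sum_n_le_series.
Qed.

(** * Sequences of nonnegative coefficients *)

(** For nonnegative [e] this is equivalent to [sum_k e k * r ^ k < L] for every [0 < r < 1], as the
    next lemmas show, but it is stated without [r] and is stable under convex combinations. *)
Definition subcritical (e : nat -> R) (L : R) : Prop :=
  e 0%nat < L /\ forall K, sum_n e K <= L.

Lemma sum_n_SR (u : nat -> R) n : sum_n u (S n) = sum_n u n + u (S n).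
Proof. apply (sum_Sn (G := R_AbelianMonoid)). Qed.

Lemma term_le_sum_n (u : nat -> R) k : (forall i, 0 <= u i) -> u k <= sum_n u k.
Proof.
  intros Hu. destruct k as [|k]; [rewrite sum_O; lra|].
  rewrite sum_n_SR. assert (0 <= sum_n u k); [|lra].
  induction k as [|k IH]; [rewrite sum_O; apply Hu|].
  rewrite sum_n_SR. generalize (Hu (S k)). lra.
Qed.

(** Bernoulli's inequality, used to choose an explicit [r] close to 1. *)
Lemma one_minus_pow_ge (x : R) (n : nat) : 0 <= x <= 1 -> 1 - INR n * x <= (1 - x) ^ n.
Proof.
  intros Hx. induction n as [|n IH]; [simpl; lra|].
  rewrite S_INR. simpl. assert (0 <= INR n) by apply pos_INR.
  assert ((1 - INR n * x) * (1 - x) <= (1 - x) ^ n * (1 - x)) by (apply Rmult_le_compat_r; lra).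
  nra.
Qed.

Lemma subcritical_of_series (e : nat -> R) (L : R) :
  (forall k, 0 <= e k) ->
  (forall r, 0 < r < 1 -> exists l, is_series (fun k => e k * r ^ k) l /\ l < L) ->
  subcritical e L.
Proof.
  intros He H.
  assert (Hp : forall r k, 0 < r -> 0 <= e k * r ^ k).
  { intros r k Hr. apply Rmult_le_pos; [apply He|apply pow_le; lra]. }
  assert (H0 : e 0%nat < L).
  { destruct (H (1 / 2)) as [l [Hl HlL]]; [lra|].
    generalize (sum_n_le_series _ _ 0 (fun k => Hp (1 / 2) k ltac:(lra)) Hl).
    rewrite sum_O. simpl. lra. }
  split; [exact H0|]. intros K.
  destruct (Rle_or_lt (sum_n e K) L) as [Hle|Hlt]; [exact Hle|exfalso].
  set (sK := sum_n e K) in *.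
  assert (HS : 0 < sK) by (generalize (He 0%nat); lra).
  assert (HK := pos_INR K).
  (* Chosen so that [K * x * sK < (sK - L) / 2]. By Bernoulli, and since [r ^ k >= r ^ K] for
     [k <= K], the partial sum at [r = 1 - x] still exceeds [L]. *)
  set (x := (sK - L) / (2 * (INR K + 1) * sK)).
  assert (Hden : 0 < 2 * (INR K + 1) * sK) by nra.
  assert (Hx : x * (2 * (INR K + 1) * sK) = sK - L) by (unfold x; field; lra).
  assert (Hx0 : 0 < x) by (apply Rdiv_lt_0_compat; lra).
  assert (Hx1 : x < 1).
  { apply (Rlt_div_l _ _ _ Hden). generalize (He 0%nat). nra. }
  destruct (H (1 - x)) as [l [Hl HlL]]; [lra|].
  assert (Hs := sum_n_le_series _ _ K (fun k => Hp (1 - x) k ltac:(lra)) Hl).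
  assert (Hm : (1 - x) ^ K * sK <= sum_n (fun k => e k * (1 - x) ^ k) K).
  { unfold sK. rewrite <- (sum_n_mult_l (K := R_Ring) ((1 - x) ^ K)).
    clear - He Hx0 Hx1.
    assert (Hq : forall n, (n <= K)%nat -> sum_n (fun k => mult ((1 - x) ^ K) (e k)) n
                 <= sum_n (fun k => e k * (1 - x) ^ k) n).
    { assert (Hpk : forall k, (k <= K)%nat -> (1 - x) ^ K * e k <= e k * (1 - x) ^ k).
      { intros k Hk. rewrite (Rmult_comm (e k)). apply Rmult_le_compat_r; [apply He|].
        replace K with ((K - k) + k)%nat by lia. rewrite pow_add.
        rewrite <- (Rmult_1_l ((1 - x) ^ k)) at 2. apply Rmult_le_compat_r; [apply pow_le; lra|].
        apply Rle_trans with (1 ^ (K - k)); [apply pow_incr; lra|rewrite pow1; lra]. }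
      induction n as [|n IH]; intros Hn.
      - rewrite !sum_O. now apply Hpk.
      - rewrite !sum_n_SR. apply Rplus_le_compat; [apply IH; lia|now apply Hpk]. }
    now apply Hq. }
  assert (Hb := one_minus_pow_ge x K ltac:(lra)).
  assert ((1 - INR K * x) * sK <= (1 - x) ^ K * sK) by (apply Rmult_le_compat_r; lra).
  nra.
Qed.

(** All terms but the first gain a factor at most [r], so [L'] is a proper average of [e 0 < L] and
    [L]. One [L'] for all [K] keeps the inequality strict in the limit. *)
Lemma subcritical_weighted (e : nat -> R) (L r : R) :
  (forall k, 0 <= e k) -> subcritical e L -> 0 <= r < 1 ->
  exists L', L' < L /\ forall K, sum_n (fun k => e k * r ^ k) K <= L'.
Proof.
  intros He [H0 HL] Hr. exists (e 0%nat + r * (L - e 0%nat)). split; [nra|].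
  intros K.
  apply Rle_trans with (e 0%nat + r * (sum_n e K - e 0%nat)).
  - induction K as [|K IH]; [rewrite !sum_O; simpl; lra|].
    rewrite !sum_n_SR.
    assert (e (S K) * r ^ S K <= r * e (S K)); [|lra].
    rewrite (Rmult_comm r). apply Rmult_le_compat_l; [apply He|].
    rewrite <- (Rmult_1_r r) at 2. simpl. apply Rmult_le_compat_l; [lra|].
    apply Rle_trans with (1 ^ K); [apply pow_incr; lra|rewrite pow1; lra].
  - apply Rplus_le_compat_l, Rmult_le_compat_l; [lra|]. generalize (HL K); lra.
Qed.

(** Since the total mass is 1, some weight is positive, and its term alone gives a gap in the
    nonnegative series of [t j * (L - e j)]. *)
Lemma is_series_weighted_lt (t e : nat -> R) (l L : R) :
  (forall j, 0 <= t j) -> is_series t 1 -> (forall j, e j < L) ->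
  is_series (fun j => t j * e j) l -> l < L.
Proof.
  intros Ht Ht1 He Hl.
  assert (Hd : is_series (fun j => t j * (L - e j)) (1 * L - l)).
  { apply is_series_ext with (fun j => minus (t j * L) (t j * e j)).
    - intros j. unfold minus, plus, opp; simpl. ring.
    - apply (is_series_minus (V := R_NormedModule)); [now apply is_series_scal_r|exact Hl]. }
  assert (Hp : forall j, 0 <= t j * (L - e j)).
  { intros j. apply Rmult_le_pos; [apply Ht|generalize (He j); lra]. }
  destruct (classic (exists j, 0 < t j)) as [[j Hj]|Hn].
  - assert (t j * (L - e j) <= 1 * L - l).
    { eapply Rle_trans; [now apply (term_le_sum_n _ j Hp)|now apply sum_n_le_series]. }
    assert (0 < t j * (L - e j)) by (apply Rmult_lt_0_compat; [exact Hj|generalize (He j); lra]).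
    lra.
  - exfalso. assert (H0 : forall j, t j = 0).
    { intros j. destruct (Ht j) as [Hj|Hj]; [destruct Hn; now exists j|now symmetry]. }
    assert (is_series t (0 * 1)).
    { apply is_series_ext with (fun j => scal 0 (t j)).
      - intros j. rewrite H0. apply Rmult_0_r.
      - now apply (is_series_scal (V := R_NormedModule)). }
    apply is_series_unique in H. apply is_series_unique in Ht1. lra.
Qed.

Lemma is_series_weighted_le (t e : nat -> R) (l L : R) :
  (forall j, 0 <= t j) -> is_series t 1 -> (forall j, e j <= L) ->
  is_series (fun j => t j * e j) l -> l <= L.
Proof.
  intros Ht Ht1 He Hl. apply Rnot_lt_le. intros Hlt.
  (* If [L < l], all [e j] lie strictly below [l] itself, so the strict version would give
     [l < l]. *)
  apply (Rlt_irrefl l), (is_series_weighted_lt t e l l Ht Ht1); [|exact Hl].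
  intros j. generalize (He j). lra.
Qed.

Lemma subcritical_convex (t : nat -> R) (e : nat -> nat -> R) (E : nat -> R) (L : R) :
  (forall j, 0 <= t j) -> is_series t 1 ->
  (forall j, subcritical (e j) L) ->
  (forall k, is_series (fun j => t j * e j k) (E k)) ->
  subcritical E L.
Proof.
  intros Ht Ht1 He HE. split.
  - apply (is_series_weighted_lt t (fun j => e j 0%nat)); auto. intros j; apply He.
  - intros K. apply (is_series_weighted_le t (fun j => sum_n (e j) K)); auto.
    + intros j; apply He.
    + induction K as [|K IH].
      * rewrite sum_O. apply is_series_ext with (2 := HE 0%nat). intros j. now rewrite sum_O.
      * rewrite sum_n_SR.
        apply is_series_ext with (fun j => plus (t j * sum_n (e j) K) (t j * e j (S K))).
        { intros j. rewrite sum_n_SR. unfold plus; simpl. ring. }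
        apply (is_series_plus (V := R_NormedModule)); [exact IH|apply HE].
Qed.

(** * Harmonic series and the half-plane criterion *)

Lemma cseries_RtoC (u : nat -> R) (l : R) :
  is_series u l -> cseries (fun j => RtoC (u j)) (RtoC l).
Proof.
  intros Hl. apply cseries_iff.
  apply is_lim_seq_ext with (fun i => Rabs (sum_n u i - l)).
  - intros i. rewrite <- Cmod_R, RtoC_minus. do 2 f_equal.
    induction i as [|i IH]; [now rewrite csum_O, sum_O|].
    now rewrite csum_S, sum_n_SR, RtoC_plus, IH.
  - replace 0 with (Rabs (l - l)) by (rewrite Rminus_diag, Rabs_R0; reflexivity).
    apply (is_lim_seq_abs _ (l - l)).
    apply is_lim_seq_minus'; [exact Hl|apply is_lim_seq_const].
Qed.

(** [kron 1] is the coefficient sequence of the identity map, so [kron 1 k - a k] is that of [h];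
    [kron 0] is that of the constant 1. *)
Definition kron (i k : nat) : R := if Nat.eqb i k then 1 else 0.

Lemma is_series_delta0 : is_series (kron 0) 1.
Proof.
  change (is_lim_seq (sum_n (kron 0)) 1).
  apply is_lim_seq_ext with (fun _ => 1); [|apply is_lim_seq_const].
  intros n. induction n as [|n IH]; [now rewrite sum_O|].
  rewrite sum_n_SR, <- IH. unfold kron; simpl. ring.
Qed.

Lemma cseries_delta1 (c : C) : cseries (fun k => kron 1 k * c)%C c.
Proof.
  apply cseries_iff, is_lim_seq_incr_1.
  apply is_lim_seq_ext with (fun _ => 0); [|apply is_lim_seq_const].
  intros n. assert (H : csum (fun k => kron 1 k * c)%C (S n) = c).
  { induction n as [|n IH]; [rewrite csum_S, csum_O|rewrite csum_S, IH];
      unfold kron; simpl; ring. }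
  rewrite H. replace (c - c)%C with (RtoC 0) by ring. now rewrite Cmod_0.
Qed.

Definition hterm (x y : nat -> R) (z : C) (k : nat) : C :=
  (x k * z ^ k + y k * Cconj z ^ k)%C.

Lemma cpseries_hterm (x y : nat -> R) (z l l' : C) :
  cpseries (fun k => RtoC (x k)) z l -> cpseries (fun k => RtoC (y k)) z l' ->
  cseries (hterm x y z) (l + Cconj l')%C.
Proof.
  rewrite !cpseries_cseries. intros Hl Hl'.
  apply cseries_ext with (2 := cseries_plus _ _ _ _ Hl (cseries_conj _ _ Hl')).
  intros k. unfold hterm. rewrite Cmult_conj, Cpow_conj.
  replace (Cconj (y k)) with (RtoC (y k)) by (unfold Cconj, RtoC; simpl; now rewrite Ropp_0).
  ring.
Qed.

Lemma Cmod_hterm_le (x y : nat -> R) (z : C) (k : nat) :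
  Cmod (hterm x y z k) <= (Rabs (x k) + Rabs (y k)) * Cmod z ^ k.
Proof.
  unfold hterm. eapply Rle_trans; [apply Cmod_triangle|].
  rewrite !Cmod_mult, !Cmod_R, !Cmod_pow, Cmod_conj. lra.
Qed.

(** With [w = A / B], the hypothesis says that [w] is closer to [1] than to [2 eta - 1]; the
    perpendicular bisector of these points is [Re w = eta]. For [B = 0] it would read
    [|A| < |A|]. *)
Lemma Re_quotient_gt (eta : R) (A B : C) : eta < 1 ->
  Cmod (A - B) < Cmod (A + (1 - 2 * eta) * B) -> B <> 0 /\ eta < Re (A / B).
Proof.
  intros Heta H. assert (HB : B <> 0).
  { intros ->. apply (Rlt_irrefl (Cmod A)).
    replace A with (A - 0)%C at 1 by ring.
    replace A with (A + (1 - 2 * eta) * 0)%C at 2 by ring. exact H. }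
  split; [exact HB|]. set (w := (A / B)%C).
  assert (HA : A = (w * B)%C) by (unfold w; field; exact HB).
  rewrite HA in H.
  replace (w * B - B)%C with ((w - 1) * B)%C in H by ring.
  replace (w * B + (1 - 2 * eta) * B)%C with ((w + (1 - 2 * eta)%R) * B)%C in H
    by (rewrite RtoC_minus, RtoC_mult; ring).
  rewrite !Cmod_mult in H. apply Rmult_lt_reg_r in H; [|now apply Cmod_gt_0].
  unfold Cmod in H. apply sqrt_lt_0_alt in H. destruct w as [u v]. simpl in *. nra.
Qed.

(** * Coefficient characterization of the class *)

(** Termwise majorant of [|h' - 1| + |g'|]. *)
Definition distortion_coef (a b : nat -> R) (k : nat) : R :=
  INR (S k) * (a (S k) + b (S k)).

(* [s] stands for [(-1)^(m+n+1)]. As in [distortion_coef], entry [k] belongs to the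
   coefficients of index [k + 1]. *)
Definition starlike_coef (M N : nat -> R) (eta s : R) (a b : nat -> R) (k : nat) : R :=
  (M (S k) - eta * N (S k)) * a (S k) + (M (S k) + s * eta * N (S k)) * b (S k).

(** [hcoef] and [gcoef] ignore [a 0], [a 1] and [b 0]. Setting them to zero makes the closed forms
    [kron 1 k - a k] and [(-1) ^ (m + 1) * b k] valid at every index. *)
Definition coef_class (M N : nat -> R) (eta s : R) (a b : nat -> R) : Prop :=
  (forall k, 0 <= a k) /\ (forall k, 0 <= b k) /\
  a 0%nat = 0 /\ a 1%nat = 0 /\ b 0%nat = 0 /\
  subcritical (distortion_coef a b) 1 /\
  subcritical (starlike_coef M N eta s a b) (1 - eta).

Lemma sign_sqr (n : nat) : (-1) ^ n * (-1) ^ n = 1.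
Proof. rewrite <- pow_add, <- (pow_1_even n). f_equal. lia. Qed.

Lemma Rabs_sign_mult (n : nat) (x : R) : Rabs ((-1) ^ n * x) = Rabs x.
Proof. rewrite Rabs_mult, pow_1_abs, Rmult_1_l. reflexivity. Qed.

Lemma distortion_coef_ge_0 (a b : nat -> R) k :
  (forall k, 0 <= a k) -> (forall k, 0 <= b k) -> 0 <= distortion_coef a b k.
Proof.
  intros Ha Hb. apply Rmult_le_pos; [apply pos_INR|].
  apply Rplus_le_le_0_compat; auto.
Qed.

Lemma starlike_coef_ge_0 (M N : nat -> R) (eta s : R) (a b : nat -> R) k :
  (forall k, 0 <= N k <= M k) -> 0 <= eta < 1 -> -1 <= s <= 1 ->
  (forall k, 0 <= a k) -> (forall k, 0 <= b k) -> 0 <= starlike_coef M N eta s a b k.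
Proof.
  intros HN Heta Hs Ha Hb. destruct (HN (S k)) as [HN0 HNM].
  assert (- 1 <= s * eta) by nra.
  apply Rplus_le_le_0_compat; apply Rmult_le_pos; auto; nra.
Qed.

(** * Necessity of the two coefficient conditions *)

Lemma sense_preserving_subcritical (a b x : nat -> R) (m : nat) (H G : C -> C) :
  (forall k, 0 <= a k) -> (forall k, 0 <= b k) -> a 1%nat = 0 ->
  (forall k, x k = kron 1 k - a k) ->
  (forall z, inU z -> cpseries (fun k => RtoC (x k)) z (H z)) ->
  (forall z, inU z -> cpseries (fun k => RtoC ((-1) ^ m * b k)) z (G z)) ->
  (forall z, inU z -> exists dH dG, cderive H z dH /\ cderive G z dG /\ Cmod dG < Cmod dH) ->
  subcritical (distortion_coef a b) 1.
Proof.
  intros Ha Hb Ha1 Hx HH HG Hsp.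
  set (X := fun k => INR (S k) * x (S k)). set (Y := fun k => INR (S k) * ((-1) ^ m * b (S k))).
  assert (HXY : forall r, 0 < r < 1 -> exists u v,
            is_pseries X r u /\ is_pseries Y r v /\ Rabs v < Rabs u).
  { intros r Hr.
    assert (Hz : inU (RtoC r)) by (unfold inU; rewrite Cmod_R, Rabs_pos_eq; lra).
    destruct (Hsp _ Hz) as [dH [dG [HdH [HdG Hlt]]]].
    destruct (cpseries_derive _ _ HH _ Hz) as [u [Hu HuD]].
    destruct (cpseries_derive _ _ HG _ Hz) as [v [Hv HvD]].
    (* Uniqueness of the complex derivative identifies the given derivatives with the termwise
       ones. *)
    assert (u = dH) by (rewrite <- (is_C_derive_unique _ _ _ HdH); symmetry; now apply is_C_derive_unique).
    assert (v = dG) by (rewrite <- (is_C_derive_unique _ _ _ HdG); symmetry; now apply is_C_derive_unique).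
    subst dH dG.
    destruct (cpseries_real X r u) as [Hu1 Hu2].
    { refine (is_pseries_ext _ _ _ _ _ Hu). intros k; symmetry; apply RtoC_mult. }
    destruct (cpseries_real Y r v) as [Hv1 Hv2].
    { refine (is_pseries_ext _ _ _ _ _ Hv). intros k; symmetry; apply RtoC_mult. }
    exists (Re u), (Re v). repeat split; try assumption.
    rewrite Hu2, Hv2, !Cmod_R in Hlt. exact Hlt. }
  assert (Hpos : forall r, 0 < r < 1 -> 0 < PSeries X r).
  { apply PSeries_pos.
    - intros r Hr. destruct (HXY r Hr) as [u [v [Hu _]]]. now exists u.
    - unfold X. rewrite Hx, Ha1. unfold kron; simpl. lra.
    - intros r Hr. destruct (HXY r Hr) as [u [v [Hu [_ Huv]]]].
      rewrite (is_pseries_unique _ _ _ Hu). intros ->.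
      rewrite Rabs_R0 in Huv. generalize (Rabs_pos v). lra. }
  apply subcritical_of_series.
  { intros k. now apply distortion_coef_ge_0. }
  intros r Hr. destruct (HXY r Hr) as [u [v [Hu [Hv Huv]]]].
  specialize (Hpos r Hr). rewrite (is_pseries_unique _ _ _ Hu) in Hpos.
  apply is_pseries_R in Hu. apply is_pseries_R in Hv.
  (* Here [1 - u] carries the [a] part and [(-1) ^ m * v] the [b] part; [u > 0] and [|v| < |u|] make
     the total less than 1. *)
  exists (1 - u + (-1) ^ m * v). split.
  - apply is_series_ext with (fun k => plus (minus (kron 0 k) (X k * r ^ k)) (scal ((-1) ^ m) (Y k * r ^ k))).
    + intros k. unfold plus, minus, opp, scal, mult, distortion_coef, X, Y; simpl plus; simpl.
      unfold mult, plus, opp; simpl.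
      replace ((-1) ^ m * (match k with 0%nat => 1 | S _ => INR k + 1 end * ((-1) ^ m * b (S k)) * r ^ k))
        with (((-1) ^ m * (-1) ^ m) * (match k with 0%nat => 1 | S _ => INR k + 1 end * b (S k) * r ^ k)) by ring.
      rewrite sign_sqr, Hx. destruct k as [|k]; unfold kron; simpl; try rewrite Ha1; ring.
    + apply (is_series_plus (V := R_NormedModule)).
      * apply (is_series_minus (V := R_NormedModule)); [apply is_series_delta0|exact Hu].
      * now apply (is_series_scal (V := R_NormedModule)).
  - assert (Rabs ((-1) ^ m * v) < Rabs u) by now rewrite Rabs_sign_mult.
    rewrite (Rabs_pos_eq u) in H0 by lra. apply Rabs_def2 in H0. lra.
Qed.

Lemma quotient_subcritical (M N a b x : nat -> R) (m n : nat) (eta : R) :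
  (forall k, 0 <= N k <= M k) -> M 1%nat = 1 -> N 1%nat = 1 -> 0 <= eta < 1 ->
  (forall k, 0 <= a k) -> (forall k, 0 <= b k) -> a 0%nat = 0 -> a 1%nat = 0 -> b 0%nat = 0 ->
  b 1%nat < 1 ->
  (forall k, x k = kron 1 k - a k) ->
  (forall z, inU z -> z <> 0 -> exists Hm Gm Hn Gn,
     cpseries (fun k => RtoC (M k * x k)) z Hm /\
     cpseries (fun k => RtoC (M k * ((-1) ^ (m + 1) * b k))) z Gm /\
     cpseries (fun k => RtoC (N k * x k)) z Hn /\
     cpseries (fun k => RtoC (N k * ((-1) ^ (m + 1) * b k))) z Gn /\
     PhiHarm n Hn Gn <> 0 /\ eta < Re (PhiHarm m Hm Gm / PhiHarm n Hn Gn)) ->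
  subcritical (starlike_coef M N eta ((-1) ^ n * (-1) ^ (m + 1)) a b) (1 - eta).
Proof.
  intros HN HM1 HN1 Heta Ha Hb Ha0 Ha1 Hb0 Hb1 Hx Hq.
  set (s := (-1) ^ n * (-1) ^ (m + 1)).
  assert (Hs : Rabs s = 1) by (unfold s; rewrite Rabs_sign_mult; apply pow_1_abs).
  assert (Hs1 : -1 <= s <= 1) by (apply Rabs_le_between; lra).
  (* Coefficients of [Phi^m f] and, below, of [Phi^n f] on the real axis. For [Phi^m f] the signs of
     [Phi^m] and of [g_m] always multiply to [-1]; for [Phi^n f] they multiply to [s]. *)
  set (A := fun k => M k * x k - M k * b k).
  set (B := fun k => N k * x k + s * (N k * b k)).
  assert (HAB : forall r, 0 < r < 1 -> exists u v,
     is_series (fun k => A (S k) * r ^ k) u /\ is_series (fun k => B (S k) * r ^ k) v /\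
     v <> 0 /\ eta < u / v).
  { intros r Hr.
    assert (Hz : inU (RtoC r)) by (unfold inU; rewrite Cmod_R, Rabs_pos_eq; lra).
    destruct (Hq _ Hz) as [Hm [Gm [Hn [Gn [H1 [H2 [H3 [H4 [H5 H6]]]]]]]]].
    { intros H0. apply RtoC_inj in H0. lra. }
    apply cpseries_real in H1, H2, H3, H4.
    destruct H1 as [H1 E1], H2 as [H2 E2], H3 as [H3 E3], H4 as [H4 E4].
    apply is_pseries_R in H1, H2, H3, H4.
    set (hm := Re Hm) in *. set (gm := Re Gm) in *. set (hn := Re Hn) in *. set (gn := Re Gn) in *.
    assert (Hharm : forall j h g, PhiHarm j (RtoC h) (RtoC g) = RtoC (h + (-1) ^ j * g)).
    { intros j h g. unfold PhiHarm, Cconj, RtoC, Cplus, Cmult; simpl. f_equal; ring. }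
    rewrite E3, E4, Hharm in H5. rewrite E1, E2, E3, E4, !Hharm in H6.
    assert (Hv : hn + (-1) ^ n * gn <> 0) by (intros H0; apply H5; now rewrite H0).
    rewrite <- RtoC_div in H6 by exact Hv. simpl in H6.
    (* Dividing both series by [r] leaves the quotient unchanged and gives the denominator the
       constant term [1 + s * b 1], positive since [b 1 < 1]; [PSeries_pos] needs this. *)
    assert (Hshift : forall c l, c 0%nat = 0 -> is_series (fun k => c k * r ^ k) l ->
              is_series (fun k => c (S k) * r ^ k) (/ r * l)).
    { intros c l Hc Hl.
      apply is_series_ext with (fun k => scal (/ r) (c (S k) * r ^ S k)).
      - intros k. unfold scal; simpl; unfold mult; simpl. field. lra.
      - apply (is_series_scal (V := R_NormedModule)).
        apply (is_series_incr_1 (V := R_NormedModule) (fun k => c k * r ^ k)).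
        rewrite Hc, Rmult_0_l.
        replace (plus l 0) with l by (symmetry; apply Rplus_0_r). exact Hl. }
    exists (/ r * (hm + (-1) ^ m * gm)), (/ r * (hn + (-1) ^ n * gn)). repeat split.
    - apply Hshift.
      + unfold A. rewrite Hx, Ha0, Hb0. unfold kron; simpl. ring.
      + apply is_series_ext with
          (fun k => plus (M k * x k * r ^ k) (scal ((-1) ^ m) (M k * ((-1) ^ (m + 1) * b k) * r ^ k))).
        * intros k. unfold plus, scal, mult; simpl. unfold mult, A; simpl. rewrite pow_add. simpl.
          transitivity (M k * x k * r ^ k - ((-1) ^ m * (-1) ^ m) * (M k * b k * r ^ k)); [ring|].
          rewrite sign_sqr. ring.
        * apply (is_series_plus (V := R_NormedModule)); [exact H1|].
          now apply (is_series_scal (V := R_NormedModule)).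
    - apply Hshift.
      + unfold B. rewrite Hx, Ha0, Hb0. unfold kron; simpl. ring.
      + apply is_series_ext with
          (fun k => plus (N k * x k * r ^ k) (scal ((-1) ^ n) (N k * ((-1) ^ (m + 1) * b k) * r ^ k))).
        * intros k. unfold plus, scal, mult; simpl. unfold mult, B, s; simpl. ring.
        * apply (is_series_plus (V := R_NormedModule)); [exact H3|].
          now apply (is_series_scal (V := R_NormedModule)).
    - apply Rmult_integral_contrapositive. split; [apply Rinv_neq_0_compat; lra|exact Hv].
    - replace (/ r * (hm + (-1) ^ m * gm) / (/ r * (hn + (-1) ^ n * gn)))
        with ((hm + (-1) ^ m * gm) / (hn + (-1) ^ n * gn)) by (field; split; [lra|exact Hv]).
      exact H6. }
  assert (Hpos : forall r, 0 < r < 1 -> 0 < PSeries (fun k => B (S k)) r).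
  { apply PSeries_pos.
    - intros r Hr. destruct (HAB r Hr) as [u [v [_ [Hv _]]]]. exists v. now apply is_pseries_R.
    - unfold B. rewrite Hx, Ha1, HN1. unfold kron; simpl. generalize (Hb 1%nat). nra.
    - intros r Hr. destruct (HAB r Hr) as [u [v [_ [Hv [Hv0 _]]]]].
      apply is_pseries_R in Hv. now rewrite (is_pseries_unique _ _ _ Hv). }
  apply subcritical_of_series.
  { intros k. now apply starlike_coef_ge_0. }
  intros r Hr. destruct (HAB r Hr) as [u [v [Hu [Hv [_ Huv]]]]].
  specialize (Hpos r Hr).
  rewrite (is_pseries_unique _ _ _ (proj2 (is_pseries_R _ _ _) Hv)) in Hpos.
  (* The coefficients of [u - eta * v] are those of [1 - eta] minus [starlike_coef]; positivity of
     [v] turns [eta < u / v] into [eta * v < u]. *)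
  exists ((1 - eta) * 1 - (u - eta * v)). split.
  - apply is_series_ext with (fun k => minus (scal (1 - eta) (kron 0 k))
      (minus (A (S k) * r ^ k) (scal eta (B (S k) * r ^ k)))).
    + intros k. unfold minus, plus, opp, scal; simpl. unfold mult; simpl.
      unfold A, B, starlike_coef. rewrite Hx.
      destruct k as [|k]; unfold kron; simpl; [rewrite HM1, HN1|]; ring.
    + repeat apply (is_series_minus (V := R_NormedModule)); try exact Hu;
        apply (is_series_scal (V := R_NormedModule)); [apply is_series_delta0|exact Hv].
  - apply (Rlt_div_r _ _ v Hpos) in Huv. lra.
Qed.

(** * Sufficiency of the two coefficient conditions *)

Lemma coef_class_le_1 (M N : nat -> R) (eta s : R) (a b : nat -> R) k :
  coef_class M N eta s a b -> a k <= 1 /\ b k <= 1.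
Proof.
  intros (Ha & Hb & Ha0 & Ha1 & Hb0 & [_ H1] & _).
  destruct k as [|k]; [lra|].
  assert (H : distortion_coef a b k <= 1).
  { eapply Rle_trans; [|apply (H1 k)]. apply term_le_sum_n.
    intros i. now apply distortion_coef_ge_0. }
  unfold distortion_coef in H. rewrite S_INR in H.
  generalize (pos_INR k) (Ha (S k)) (Hb (S k)). nra.
Qed.

(** Both weights in [starlike_coef] are at least [(1 - eta) * M], because [N <= M] and [s >= -1],
    and [1 - eta] cancels. With this bound all series involved converge in the disc. *)
Lemma coef_class_mult_le_1 (M N : nat -> R) (eta s : R) (a b : nat -> R) k :
  (forall k, 0 <= N k <= M k) -> 0 <= eta < 1 -> -1 <= s <= 1 ->
  coef_class M N eta s a b -> M k * a k <= 1 /\ M k * b k <= 1.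
Proof.
  intros HN Heta Hs (Ha & Hb & Ha0 & Ha1 & Hb0 & _ & [_ H2]).
  destruct k as [|k]; [rewrite Ha0, Hb0; lra|].
  assert (H : starlike_coef M N eta s a b k <= 1 - eta).
  { eapply Rle_trans; [|apply (H2 k)]. apply term_le_sum_n.
    intros i. now apply starlike_coef_ge_0. }
  unfold starlike_coef in H. destruct (HN (S k)) as [HN0 HNM].
  assert (Hse : - eta <= s * eta) by nra.
  assert (HsN : (1 - eta) * M (S k) <= M (S k) + s * eta * N (S k)) by nra.
  assert (HeN : (1 - eta) * M (S k) <= M (S k) - eta * N (S k)) by nra.
  generalize (Rmult_le_compat_r _ _ _ (Hb (S k)) HsN) (Rmult_le_compat_r _ _ _ (Ha (S k)) HeN).
  assert (0 <= M (S k) * a (S k)) by (apply Rmult_le_pos; [lra|apply Ha]).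
  assert (0 <= M (S k) * b (S k)) by (apply Rmult_le_pos; [lra|apply Hb]).
  intros. split; apply Rmult_le_reg_l with (1 - eta); nra.
Qed.

Lemma ex_cpseries_mult (M c : nat -> R) (z : C) :
  (forall k, Rabs (M k * c k) <= 1) -> M 1%nat = 1 -> inU z ->
  exists l, cpseries (fun k => RtoC (M k * (kron 1 k - c k))) z l.
Proof.
  intros Hc HM. apply ex_cpseries_bounded with 2. intros k. rewrite Cmod_R.
  replace (M k * (kron 1 k - c k)) with (M k * kron 1 k + - (M k * c k)) by ring.
  eapply Rle_trans; [apply Rabs_triang|]. rewrite Rabs_Ropp.
  assert (Rabs (M k * kron 1 k) <= 1); [|generalize (Hc k); lra].
  destruct (Nat.eqb_spec 1 k) as [<-|Hk].
  - unfold kron; simpl. rewrite HM, Rabs_pos_eq; lra.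
  - unfold kron. apply Nat.eqb_neq in Hk. rewrite Hk, Rmult_0_r, Rabs_R0. lra.
Qed.

(** On a disc of radius [rho < 1] containing both points, [f] minus the identity is Lipschitz with
    constant [L' < 1]; hence [f z = f w] forces [|z - w| <= L' * |z - w|]. *)
Lemma distortion_injective (a b x : nat -> R) (m : nat) (f : C -> C) :
  (forall k, 0 <= a k) -> (forall k, 0 <= b k) -> a 0%nat = 0 -> b 0%nat = 0 ->
  subcritical (distortion_coef a b) 1 ->
  (forall k, x k = kron 1 k - a k) ->
  (forall z, inU z -> cseries (hterm x (fun k => (-1) ^ m * b k) z) (f z)) ->
  forall z w, inU z -> inU w -> f z = f w -> z = w.
Proof.
  intros Ha Hb Ha0 Hb0 Hsub Hx Hf z w Hz Hw Hzw. unfold inU in *.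
  set (rho := Rmax (Cmod z) (Cmod w)).
  assert (Hrho : 0 <= rho < 1).
  { split; [eapply Rle_trans; [apply (Cmod_ge_0 z)|apply Rmax_l]|now apply Rmax_lub_lt]. }
  destruct (subcritical_weighted _ _ rho (fun k => distortion_coef_ge_0 a b k Ha Hb) Hsub Hrho)
    as [L' [HL' HS]].
  assert (HD := cseries_minus _ _ _ _
     (cseries_minus _ _ _ _ (Hf z Hz) (Hf w Hw)) (cseries_delta1 (z - w)%C)).
  apply cseries_incr_1 in HD.
  2: { unfold hterm. rewrite Hb0, Rmult_0_r. unfold kron; simpl. ring. }
  assert (Hle : Cmod (f z - f w - (z - w)) <= L' * Cmod (z - w)).
  { apply cseries_Cmod_le with (1 := HD). intros K.
    apply Rle_trans with (sum_n (fun k => distortion_coef a b k * rho ^ k * Cmod (z - w)) K).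
    - apply sum_n_Rle. intros k. unfold hterm. rewrite !Hx, !RtoC_minus, !RtoC_mult.
      replace (_ - _)%C with
        (- (a (S k) * (z ^ S k - w ^ S k))
         + RtoC ((-1) ^ m) * b (S k) * (Cconj z ^ S k - Cconj w ^ S k))%C.
      2: { destruct k as [|k]; unfold kron; simpl Nat.eqb; cbv iota; simpl Cpow; ring. }
      eapply Rle_trans; [apply Cmod_triangle|].
      rewrite Cmod_opp, !Cmod_mult, !Cmod_R, pow_1_abs.
      rewrite <- !Cpow_conj, <- Cminus_conj, Cmod_conj.
      rewrite !Rabs_pos_eq by auto.
      assert (Hp := Cmod_pow_diff_le w z rho k (Rmax_r _ _) (Rmax_l _ _)).
      apply Rmult_le_compat_l with (1 := Rplus_le_le_0_compat _ _ (Ha (S k)) (Hb (S k))) in Hp.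
      unfold distortion_coef. lra.
    - rewrite (sum_n_mult_r (K := R_Ring) (Cmod (z - w))).
      apply Rmult_le_compat_r; [apply Cmod_ge_0|apply HS]. }
  rewrite Hzw in Hle.
  replace (f w - f w - (z - w))%C with (- (z - w))%C in Hle by ring.
  rewrite Cmod_opp in Hle. generalize (Cmod_ge_0 (z - w)%C). intros Hp.
  assert (H0 : Cmod (z - w) = 0) by nra.
  apply Cmod_eq_0 in H0. replace z with ((z - w) + w)%C by ring. rewrite H0. ring.
Qed.

(** From [|h' - 1| + |g'| <= L' < 1] follows [|g'| < 1 - |h' - 1| <= |h'|]. *)
Lemma distortion_sense_preserving (a b x : nat -> R) (m : nat) (H G : C -> C) :
  (forall k, 0 <= a k) -> (forall k, 0 <= b k) ->
  subcritical (distortion_coef a b) 1 ->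
  (forall k, x k = kron 1 k - a k) ->
  (forall z, inU z -> cpseries (fun k => RtoC (x k)) z (H z)) ->
  (forall z, inU z -> cpseries (fun k => RtoC ((-1) ^ m * b k)) z (G z)) ->
  forall z, inU z -> exists dH dG, cderive H z dH /\ cderive G z dG /\ Cmod dG < Cmod dH.
Proof.
  intros Ha Hb Hsub Hx HH HG z Hz.
  destruct (cpseries_derive _ _ HH _ Hz) as [u [Hu HuD]].
  destruct (cpseries_derive _ _ HG _ Hz) as [v [Hv HvD]].
  exists u, v. repeat split; try apply HuD; try apply HvD.
  destruct (subcritical_weighted _ _ (Cmod z) (fun k => distortion_coef_ge_0 a b k Ha Hb) Hsub)
    as [L' [HL' HS]]; [split; [apply Cmod_ge_0|exact Hz]|].
  rewrite cpseries_cseries in Hu, Hv.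
  assert (H1 : cseries (fun k => kron 1 (S k) * 1)%C (RtoC 1)).
  { apply (cseries_incr_1 (fun k => kron 1 k * 1)%C); [unfold kron; simpl; ring|apply cseries_delta1]. }
  assert (Hle : Cmod (u - 1) + Cmod v <= L').
  { apply (cseries_Cmod_le2 _ _ _ _ _ (cseries_minus _ _ _ _ Hu H1) Hv). intros K.
    apply Rle_trans with (2 := HS K). apply sum_n_Rle. intros k.
    replace (z ^ k * (INR (S k) * x (S k)) - kron 1 (S k) * 1)%C
      with (- (z ^ k * (INR (S k) * a (S k))))%C.
    2: { rewrite Hx, RtoC_minus. destruct k as [|k]; unfold kron; simpl; ring. }
    rewrite Cmod_opp, !Cmod_mult, Cmod_pow, !Cmod_R, Rabs_sign_mult.
    rewrite !Rabs_pos_eq by (auto using pos_INR).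
    unfold distortion_coef. lra. }
  assert (H2 : Cmod 1 <= Cmod u + Cmod (u - 1)).
  { replace (RtoC 1) with (u + - (u - 1))%C at 1 by ring.
    eapply Rle_trans; [apply Cmod_triangle|]. rewrite Cmod_opp. lra. }
  rewrite Cmod_1 in H2. lra.
Qed.

(* Re (A / B) > eta is equivalent to |A - B| < |A + (1 - 2 eta) B|; in this form the triangle
   inequality is sharp for every parity of [m + n], thanks to [0 <= N <= M]. *)
Lemma starlike_quotient (M N a b x : nat -> R) (m n : nat) (eta : R) (z Hm Gm Hn Gn : C) :
  (forall k, 0 <= N k <= M k) -> M 1%nat = 1 -> N 1%nat = 1 -> 0 <= eta < 1 ->
  (forall k, 0 <= a k) -> (forall k, 0 <= b k) -> a 0%nat = 0 -> b 0%nat = 0 ->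
  subcritical (starlike_coef M N eta ((-1) ^ n * (-1) ^ (m + 1)) a b) (1 - eta) ->
  (forall k, x k = kron 1 k - a k) ->
  inU z -> z <> 0 ->
  cpseries (fun k => RtoC (M k * x k)) z Hm ->
  cpseries (fun k => RtoC (M k * ((-1) ^ (m + 1) * b k))) z Gm ->
  cpseries (fun k => RtoC (N k * x k)) z Hn ->
  cpseries (fun k => RtoC (N k * ((-1) ^ (m + 1) * b k))) z Gn ->
  PhiHarm n Hn Gn <> 0 /\ eta < Re (PhiHarm m Hm Gm / PhiHarm n Hn Gn).
Proof.
  intros HN HM1 HN1 Heta Ha Hb Ha0 Hb0 Hsub Hx Hz Hz0 H1 H2 H3 H4.
  set (s := (-1) ^ n * (-1) ^ (m + 1)) in *.
  assert (Hs : Rabs s = 1) by (unfold s; rewrite Rabs_sign_mult; apply pow_1_abs).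
  assert (Hs1 : -1 <= s <= 1) by (apply Rabs_le_between; lra).
  assert (Hharm : forall (j : nat) (P : nat -> R) (h g : C),
     cpseries (fun k => RtoC (P k * x k)) z h ->
     cpseries (fun k => RtoC (P k * ((-1) ^ (m + 1) * b k))) z g ->
     cseries (hterm (fun k => P k * x k) (fun k => (-1) ^ j * (-1) ^ (m + 1) * (P k * b k)) z)
       (PhiHarm j h g)).
  { intros j P h g Hh Hg.
    assert (Hg' : cpseries (fun k => RtoC ((-1) ^ j * (-1) ^ (m + 1) * (P k * b k))) z (RtoC ((-1) ^ j) * g)%C).
    { rewrite cpseries_cseries in Hg |- *. apply cseries_ext with (2 := cseries_scal (RtoC ((-1) ^ j)) _ _ Hg).
      intros k. rewrite !RtoC_mult. ring. }
    generalize (cpseries_hterm _ _ _ _ _ Hh Hg').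
    rewrite Cmult_conj. unfold PhiHarm.
    replace (Cconj (RtoC ((-1) ^ j))) with (RtoC ((-1) ^ j)); [trivial|].
    unfold Cconj, RtoC; simpl. now rewrite Ropp_0. }
  assert (HA : cseries (hterm (fun k => M k * x k) (fun k => - (M k * b k)) z) (PhiHarm m Hm Gm)).
  { apply cseries_ext with (2 := Hharm m M _ _ H1 H2). intros k. unfold hterm. do 3 f_equal.
    rewrite pow_add, <- !Rmult_assoc, sign_sqr. simpl. ring. }
  assert (HB := Hharm n N _ _ H3 H4). fold s in HB.
  set (A := PhiHarm m Hm Gm) in *. set (B := PhiHarm n Hn Gn) in *.
  apply Re_quotient_gt; [lra|].
  destruct (subcritical_weighted (starlike_coef M N eta s a b) (1 - eta) (Cmod z)) as [L' [HL' HS]].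
  { intros k. now apply starlike_coef_ge_0. }
  { exact Hsub. }
  { split; [apply Cmod_ge_0|exact Hz]. }
  assert (HD := cseries_minus _ _ _ _ HA HB).
  assert (HE := cseries_minus _ _ _ _ (cseries_plus _ _ _ _ HA (cseries_scal (1 - 2 * eta)%R _ _ HB))
                  (cseries_delta1 ((2 - 2 * eta)%R * z)%C)).
  apply cseries_incr_1 in HD.
  2: { unfold hterm. rewrite Hx, Ha0, Hb0. unfold kron; simpl. rewrite ?Rminus_0_r, ?Rmult_0_r, ?Ropp_0. ring. }
  apply cseries_incr_1 in HE.
  2: { unfold hterm. rewrite Hx, Ha0, Hb0. unfold kron; simpl. rewrite ?Rminus_0_r, ?Rmult_0_r, ?Ropp_0. ring. }
  (* The moduli of the coefficients add up exactly: [(M - N) + (M + (1 - 2 eta) N) = 2 (M - eta N)]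
     for [a], and [(M + s N) + (M - (1 - 2 eta) s N) = 2 (M + s eta N)] for [b]. The extra factor
     [|z|] comes from the index shift. *)
  assert (Hle : Cmod (A - B) + Cmod (A + (1 - 2 * eta)%R * B - (2 - 2 * eta)%R * z) <= 2 * Cmod z * L').
  { apply (cseries_Cmod_le2 _ _ _ _ _ HD HE). intros K.
    apply Rle_trans with (sum_n (fun k => 2 * Cmod z * (starlike_coef M N eta s a b k * Cmod z ^ k)) K).
    2: { rewrite (sum_n_mult_l (K := R_Ring) (2 * Cmod z)).
         apply Rmult_le_compat_l; [generalize (Cmod_ge_0 z); lra|apply HS]. }
    apply sum_n_Rle. intros k. destruct (HN (S k)) as [HN0 HNM].
    replace (_ - hterm _ _ z (S k))%C
      with (hterm (fun k => - ((M k - N k) * a k))%R (fun k => - ((M k + s * N k) * b k))%R z (S k)).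
    2: { unfold hterm. rewrite Hx.
         destruct k as [|k]; unfold kron; simpl Nat.eqb; cbv iota; [rewrite HM1, HN1|];
           rewrite ?RtoC_opp, ?RtoC_mult, ?RtoC_minus, ?RtoC_plus, ?RtoC_mult; ring. }
    replace (_ - kron 1 (S k) * _)%C
      with (hterm (fun k => - ((M k + (1 - 2 * eta) * N k) * a k))%R
                  (fun k => - ((M k - (1 - 2 * eta) * (s * N k)) * b k))%R z (S k)).
    2: { unfold hterm. rewrite Hx.
         destruct k as [|k]; unfold kron; simpl Nat.eqb; cbv iota; [rewrite HM1, HN1|];
           repeat (rewrite ?RtoC_opp, ?RtoC_mult, ?RtoC_minus, ?RtoC_plus); simpl Cpow; ring. }
    eapply Rle_trans; [apply Rplus_le_compat; apply Cmod_hterm_le|].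
    assert (HsN : - N (S k) <= s * N (S k) <= N (S k)) by nra.
    cbv beta. rewrite !Rabs_Ropp, !Rabs_pos_eq.
    - unfold starlike_coef. simpl. apply Req_le. ring.
    - apply Rmult_le_pos; [nra|apply Hb].
    - apply Rmult_le_pos; [nra|apply Ha].
    - apply Rmult_le_pos; [nra|apply Hb].
    - apply Rmult_le_pos; [nra|apply Ha]. }
  rewrite <- (RtoC_mult 2 eta), <- RtoC_minus.
  (* The leading term [(2 - 2 eta) z] exceeds the bound [2 |z| L'] since [L' < 1 - eta] and
     [z <> 0]; this yields the strict inequality of moduli. *)
  assert (Hlow : (2 - 2 * eta) * Cmod z <=
     Cmod (A + (1 - 2 * eta)%R * B) + Cmod (A + (1 - 2 * eta)%R * B - (2 - 2 * eta)%R * z)).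
  { rewrite <- (Rabs_pos_eq (2 - 2 * eta)) at 1 by lra. rewrite <- Cmod_R, <- Cmod_mult.
    replace ((2 - 2 * eta)%R * z)%C with
      ((A + (1 - 2 * eta)%R * B) + - (A + (1 - 2 * eta)%R * B - (2 - 2 * eta)%R * z))%C at 1 by ring.
    eapply Rle_trans; [apply Cmod_triangle|]. rewrite Cmod_opp. lra. }
  assert (0 < Cmod z) by now apply Cmod_gt_0.
  nra.
Qed.

(** * Equivalence of membership with the coefficient conditions *)

Lemma cpseries_ext (c d : nat -> C) (z l : C) :
  (forall k, c k = d k) -> cpseries c z l -> cpseries d z l.
Proof. apply (is_pseries_ext (V := C_NormedModule)). Qed.

Lemma rseries_ext (u v : nat -> R) (l : R) :
  (forall k, u k = v k) -> is_series u l -> is_series v l.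
Proof. apply (is_series_ext (V := R_NormedModule)). Qed.

Lemma hcoef_kron (a : nat -> R) k : a 0%nat = 0 -> a 1%nat = 0 ->
  hcoef a k = RtoC (kron 1 k - a k).
Proof.
  intros Ha0 Ha1. destruct k as [|[|k]]; unfold kron; simpl; f_equal; rewrite ?Ha0, ?Ha1; ring.
Qed.

Lemma gcoef_sign (m : nat) (b : nat -> R) k : b 0%nat = 0 ->
  gcoef m b k = RtoC ((-1) ^ (m + 1) * b k).
Proof. intros Hb0. destruct k as [|k]; simpl; f_equal; rewrite ?Hb0; ring. Qed.

(** Replaces the existential functions [H], [G] by one harmonic series for [f], so that only
    coefficients have to be combined. *)
Lemma SHbar_iff (alpha beta gamma delta p q eta : R) (m n : nat) (f : C -> C) :
  0 <= eta < 1 -> (n < m)%nat ->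
  SHbar alpha beta gamma delta p q m n eta f <->
  exists a b,
    coef_class (Ck alpha beta gamma delta p q m) (Ck alpha beta gamma delta p q n) eta
      ((-1) ^ n * (-1) ^ (m + 1)) a b /\
    forall z, inU z ->
      cseries (hterm (fun k => kron 1 k - a k) (fun k => (-1) ^ (m + 1) * b k) z) (f z).
Proof.
  intros Heta Hnm.
  set (M := Ck alpha beta gamma delta p q m). set (N := Ck alpha beta gamma delta p q n).
  assert (HN : forall k, 0 <= N k <= M k).
  { intros k. split; [apply Ck_ge_0|apply Ck_mono; lia]. }
  assert (Hs : -1 <= (-1) ^ n * (-1) ^ (m + 1) <= 1).
  { apply Rabs_le_between. rewrite Rabs_sign_mult, pow_1_abs. lra. }
  split.
  - intros (a0 & b0 & Ha & Hb & H & G & Hf & Hb1 & _ & Hsp & Hq).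
    (* The given sequences are arbitrary at the indices that [hcoef] and [gcoef] ignore; those
       entries are reset to zero. *)
    set (a := fun k => match k with O | S O => 0 | _ => a0 k end).
    set (b := fun k => match k with O => 0 | _ => b0 k end).
    assert (Ha' : forall k, 0 <= a k) by (intros [|[|k]]; simpl; auto; lra).
    assert (Hb' : forall k, 0 <= b k) by (intros [|k]; simpl; auto; lra).
    assert (HhE : forall k, hcoef a0 k = RtoC (kron 1 k - a k)).
    { intros k. rewrite <- hcoef_kron by reflexivity. now destruct k as [|[|k]]. }
    assert (HgE : forall k, gcoef m b0 k = RtoC ((-1) ^ (m + 1) * b k)).
    { intros k. rewrite <- gcoef_sign by reflexivity. now destruct k as [|k]. }
    assert (HH : forall z, inU z -> cpseries (fun k => RtoC (kron 1 k - a k)) z (H z)).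
    { intros z Hz. destruct (Hf z Hz) as [H1 _]. now apply cpseries_ext with (1 := HhE). }
    assert (HG : forall z, inU z -> cpseries (fun k => RtoC ((-1) ^ (m + 1) * b k)) z (G z)).
    { intros z Hz. destruct (Hf z Hz) as (_ & H2 & _). now apply cpseries_ext with (1 := HgE). }
    exists a, b. split.
    + repeat (split; [reflexivity || assumption|]). split.
      * now apply (sense_preserving_subcritical a b (fun k => kron 1 k - a k) (m + 1) H G).
      * apply (quotient_subcritical M N a b (fun k => kron 1 k - a k)); try assumption; try reflexivity.
        { apply Rabs_def2 in Hb1. simpl. lra. }
        intros z Hz Hz0.
        destruct (Hq z Hz Hz0) as (Hm & Gm & Hn & Gn & H1 & H2 & H3 & H4 & H5 & H6).
        exists Hm, Gm, Hn, Gn. repeat split; try assumption.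
        -- refine (cpseries_ext _ _ _ _ _ H1). intros k. unfold PhiC. now rewrite HhE, <- RtoC_mult.
        -- refine (cpseries_ext _ _ _ _ _ H2). intros k. unfold PhiC. now rewrite HgE, <- RtoC_mult.
        -- refine (cpseries_ext _ _ _ _ _ H3). intros k. unfold PhiC. now rewrite HhE, <- RtoC_mult.
        -- refine (cpseries_ext _ _ _ _ _ H4). intros k. unfold PhiC. now rewrite HgE, <- RtoC_mult.
    + intros z Hz. destruct (Hf z Hz) as (_ & _ & ->). apply cpseries_hterm; auto.
  - intros (a & b & Hab & Hf).
    assert (Hle := fun k => coef_class_le_1 _ _ _ _ _ _ k Hab).
    assert (HMle := fun k => coef_class_mult_le_1 _ _ _ _ _ _ k HN Heta Hs Hab).
    destruct Hab as (Ha & Hb & Ha0 & Ha1 & Hb0 & Hd & Hst).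
    assert (HhE := fun k => hcoef_kron a k Ha0 Ha1).
    assert (HgE := fun k => gcoef_sign m b k Hb0).
    assert (HNle : forall k, 0 <= N k * a k <= 1 /\ 0 <= N k * b k <= 1).
    { intros k. destruct (HN k), (HMle k). specialize (Ha k). specialize (Hb k).
      assert (N k * a k <= M k * a k) by nra. assert (N k * b k <= M k * b k) by nra.
      repeat split; try lra; now apply Rmult_le_pos. }
    assert (HMpos : forall k, 0 <= M k * a k /\ 0 <= M k * b k).
    { intros k. destruct (HN k). split; apply Rmult_le_pos; auto; lra. }
    assert (HexH : forall (P : nat -> R) z, (forall k, 0 <= P k * a k <= 1) -> P 1%nat = 1 -> inU z ->
              exists l, cpseries (fun k => RtoC (P k * (kron 1 k - a k))) z l).
    { intros P z HP HP1 Hz. apply ex_cpseries_mult; try assumption.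
      intros k. rewrite Rabs_pos_eq; apply HP. }
    assert (HexG : forall (P : nat -> R) z, (forall k, 0 <= P k * b k <= 1) -> inU z ->
              exists l, cpseries (fun k => RtoC (P k * ((-1) ^ (m + 1) * b k))) z l).
    { intros P z HP Hz. apply ex_cpseries_bounded with 1; [|exact Hz].
      intros k. rewrite Cmod_R.
      replace (P k * ((-1) ^ (m + 1) * b k)) with ((-1) ^ (m + 1) * (P k * b k)) by ring.
      rewrite Rabs_sign_mult, Rabs_pos_eq; apply HP. }
    (* The analytic parts are recovered as sums of their series; values outside the disc are set to
       0. *)
    destruct (functional_choice (fun z l => inU z -> cpseries (fun k => RtoC (kron 1 k - a k)) z l))
      as [H HH].
    { intros z. destruct (classic (inU z)) as [Hz|Hz]; [|exists (RtoC 0); tauto].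
      destruct (HexH (fun _ => 1) z) as [l Hl]; auto.
      - intros k. rewrite Rmult_1_l. split; [apply Ha|apply Hle].
      - exists l. intros _. refine (cpseries_ext _ _ _ _ _ Hl). intros k. now rewrite Rmult_1_l. }
    destruct (functional_choice (fun z l => inU z -> cpseries (fun k => RtoC ((-1) ^ (m + 1) * b k)) z l))
      as [G HG].
    { intros z. destruct (classic (inU z)) as [Hz|Hz]; [|exists (RtoC 0); tauto].
      destruct (HexG (fun _ => 1) z) as [l Hl]; auto.
      - intros k. rewrite Rmult_1_l. split; [apply Hb|apply Hle].
      - exists l. intros _. refine (cpseries_ext _ _ _ _ _ Hl). intros k. now rewrite Rmult_1_l. }
    exists a, b. repeat (split; [assumption|]). exists H, G. repeat split.
    + apply cpseries_ext with (2 := HH z H0). intros k. now rewrite HhE.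
    + apply cpseries_ext with (2 := HG z H0). intros k. now rewrite HgE.
    + apply (cseries_unique _ _ _ (Hf z H0)). apply cpseries_hterm; auto.
    + destruct Hd as [Hd _]. unfold distortion_coef in Hd. rewrite Ha1 in Hd. simpl in Hd.
      rewrite Rabs_pos_eq by apply Hb. lra.
    + now apply (distortion_injective a b (fun k => kron 1 k - a k) (m + 1) f).
    + now apply (distortion_sense_preserving a b (fun k => kron 1 k - a k) (m + 1) H G).
    + intros z Hz Hz0.
      destruct (HexH M z) as [Hm H1]; [intros k; split; [apply HMpos|apply HMle]|reflexivity|exact Hz|].
      destruct (HexG M z) as [Gm H2]; [intros k; split; [apply HMpos|apply HMle]|exact Hz|].
      destruct (HexH N z) as [Hn H3]; [intros k; apply HNle|reflexivity|exact Hz|].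
      destruct (HexG N z) as [Gn H4]; [intros k; apply HNle|exact Hz|].
      exists Hm, Gm, Hn, Gn. repeat (split; [|]).
      1-4: (eapply cpseries_ext; [|eassumption]; intros k; unfold PhiC;
            now rewrite ?HhE, ?HgE, <- RtoC_mult).
      all: apply (starlike_quotient M N a b (fun k => kron 1 k - a k) m n eta z Hm Gm Hn Gn);
        try assumption; reflexivity.
Qed.

(** * Closure under convex combinations *)

Theorem theorem4p2 (alpha beta gamma delta p q : R)
  (Halpha : 0 < alpha) (Hbeta : 0 < beta) (Hgamma : 0 < gamma) (Hdelta : 0 < delta)
  (Hp : 0 < p) (Hq : 0 < q) (Hqap : q <= alpha + p)
  (eta : R) (Heta0 : 0 <= eta) (Heta1 : eta < 1)
  (m n : nat) (Hm : (1 <= m)%nat) (Hmn : (n < m)%nat)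
  (f : nat -> Complex.C -> Complex.C) (t : nat -> R)
  (Hf : forall j, SHbar alpha beta gamma delta p q m n eta (f j))
  (Ht0 : forall j, 0 <= t j)
  (Ht1 : is_series t 1) :
  exists F : Complex.C -> Complex.C,
    (forall z, inU z ->
       is_series (K := C_AbsRing) (V := C_NormedModule)
         (fun j => Complex.Cmult (Complex.RtoC (t j)) (f j z)) (F z)) /\
    SHbar alpha beta gamma delta p q m n eta F.
Proof.
  assert (Heta : 0 <= eta < 1) by lra.
  destruct (functional_choice (fun j (ab : (nat -> R) * (nat -> R)) =>
    coef_class (Ck alpha beta gamma delta p q m) (Ck alpha beta gamma delta p q n) eta
      ((-1) ^ n * (-1) ^ (m + 1)) (fst ab) (snd ab) /\
    forall z, inU z ->
      cseries (hterm (fun k => kron 1 k - fst ab k) (fun k => (-1) ^ (m + 1) * snd ab k) z) (f j z)))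
    as [ab Hab].
  { intros j. destruct (proj1 (SHbar_iff _ _ _ _ _ _ _ _ _ _ Heta Hmn) (Hf j)) as (a & b & H).
    now exists (a, b). }
  set (M := Ck alpha beta gamma delta p q m) in *. set (N := Ck alpha beta gamma delta p q n) in *.
  set (s := (-1) ^ n * (-1) ^ (m + 1)) in *.
  assert (Hle := fun j k => coef_class_le_1 _ _ _ _ _ _ k (proj1 (Hab j))).
  assert (Hex : forall u : nat -> R, (forall j, 0 <= u j <= 1) -> ex_series (fun j => t j * u j)).
  { intros u Hu. apply (ex_series_le (V := R_CompleteNormedModule) _ t); [|now exists 1].
    intros j. change (Rabs (t j * u j) <= t j). specialize (Ht0 j). specialize (Hu j).
    rewrite Rabs_pos_eq by nra. nra. }
  set (a := fun k => Series (fun j => t j * fst (ab j) k)).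
  set (b := fun k => Series (fun j => t j * snd (ab j) k)).
  assert (Hat : forall k, is_series (fun j => t j * fst (ab j) k) (a k)).
  { intros k. apply Series_correct, Hex. intros j. split; [apply Hab|apply Hle]. }
  assert (Hbt : forall k, is_series (fun j => t j * snd (ab j) k) (b k)).
  { intros k. apply Series_correct, Hex. intros j. split; [apply Hab|apply Hle]. }
  (* At a fixed index both families are of the form [c * a + d * b], so this one identity serves
     both. *)
  assert (Hlin : forall (c d : R) k, is_series (fun j => t j * (c * fst (ab j) k + d * snd (ab j) k)) (c * a k + d * b k)).
  { intros c d k.
    apply is_series_ext with (fun j => plus (scal c (t j * fst (ab j) k)) (scal d (t j * snd (ab j) k))).
    - intros j. unfold plus, scal; simpl; unfold mult; simpl. ring.
    - apply (is_series_plus (V := R_NormedModule)); apply (is_series_scal (V := R_NormedModule)); auto. }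
  assert (Hclass : coef_class M N eta s a b).
  { assert (Hpos : forall u l, (forall j, 0 <= u j) -> is_series (fun j => t j * u j) l -> 0 <= l).
    { intros u l Hu Hl. apply Rle_trans with (sum_n (fun j => t j * u j) 0).
      - rewrite sum_O. now apply Rmult_le_pos.
      - apply sum_n_le_series; [|exact Hl]. intros j. now apply Rmult_le_pos. }
    assert (Hzero : forall u, (forall j, u j = 0) -> Series (fun j => t j * u j) = 0).
    { intros u Hu. rewrite (Series_ext _ (fun j => 0 * t j)).
      - rewrite Series_scal_l. ring.
      - intros j. rewrite Hu. ring. }
    refine (conj _ (conj _ (conj _ (conj _ (conj _ (conj _ _)))))).
    - intros k. apply (Hpos (fun j => fst (ab j) k)); [intros j; apply Hab|apply Hat].
    - intros k. apply (Hpos (fun j => snd (ab j) k)); [intros j; apply Hab|apply Hbt].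
    - apply Hzero. intros j; apply Hab.
    - apply Hzero. intros j; apply Hab.
    - apply Hzero. intros j; apply Hab.
    - apply (subcritical_convex t (fun j => distortion_coef (fst (ab j)) (snd (ab j)))); auto.
      + intros j; apply Hab.
      + intros k. unfold distortion_coef. rewrite Rmult_plus_distr_l.
        apply rseries_ext with (2 := Hlin (INR (S k)) (INR (S k)) (S k)). intros j. ring.
    - apply (subcritical_convex t (fun j => starlike_coef M N eta s (fst (ab j)) (snd (ab j)))); auto.
      + intros j; apply Hab.
      + intros k. apply Hlin. }
  set (hx := hterm (fun k => kron 1 k - a k) (fun k => (-1) ^ (m + 1) * b k)).
  (* The majorant is the same for all [j], as the exchange of summations requires; the coefficient
     of [h] at index 1 is exactly 1 because [a 1 = 0]. *)
  assert (Hmaj : forall a b, coef_class M N eta s a b -> forall z k,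
    Cmod (hterm (fun k => kron 1 k - a k) (fun k => (-1) ^ (m + 1) * b k) z k) <= 2 * Cmod z ^ k).
  { intros a' b' Hab' z k. eapply Rle_trans; [apply Cmod_hterm_le|]. cbv beta.
    apply Rmult_le_compat_r; [apply pow_le, Cmod_ge_0|].
    destruct (coef_class_le_1 _ _ _ _ _ _ k Hab') as [Ha1 Hb1].
    destruct Hab' as (Ha & Hb & _ & Ha1' & _). specialize (Ha k). specialize (Hb k).
    rewrite Rabs_sign_mult, (Rabs_pos_eq (b' k)) by exact Hb.
    assert (Rabs (kron 1 k - a' k) <= 1); [|lra].
    destruct (Nat.eqb_spec 1 k) as [<-|Hk]; unfold kron.
    - rewrite Nat.eqb_refl, Ha1', Rabs_pos_eq; lra.
    - apply Nat.eqb_neq in Hk. rewrite Hk. apply Rabs_le. lra. }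
  assert (Hgeom : forall z, inU z -> ex_series (fun k => 2 * Cmod z ^ k)).
  { intros z Hz. exists (2 * (/ (1 - Cmod z))).
    apply (is_series_scal (V := R_NormedModule) 2), is_series_geom.
    rewrite Rabs_pos_eq; [exact Hz|apply Cmod_ge_0]. }
  destruct (functional_choice (fun z l => inU z -> cseries (hx z) l)) as [F HF].
  { intros z. destruct (classic (inU z)) as [Hz|Hz]; [|exists (RtoC 0); tauto].
    destruct (ex_cseries_le (hx z) (fun k => 2 * Cmod z ^ k)) as [l Hl]; eauto. }
  exists F. split.
  - intros z Hz.
    apply cseries_convex_exchange with
      (u := fun j => hterm (fun k => kron 1 k - fst (ab j) k) (fun k => (-1) ^ (m + 1) * snd (ab j) k) z)
      (U := hx z) (rho := fun k => 2 * Cmod z ^ k); auto.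
    + intros j k. apply Hmaj, Hab.
    + intros j. now apply Hab.
    + intros k.
      (* Total mass 1 preserves the normalization: the weights times [kron 1 k] sum to
         [kron 1 k]. *)
      assert (Hx : is_series (fun j => t j * (kron 1 k - fst (ab j) k)) (1 * kron 1 k - a k)).
      { apply is_series_ext with (fun j => minus (t j * kron 1 k) (t j * fst (ab j) k)).
        - intros j. unfold minus, plus, opp; simpl. ring.
        - apply (is_series_minus (V := R_NormedModule)); [now apply is_series_scal_r|apply Hat]. }
      assert (Hy := is_series_scal_r ((-1) ^ (m + 1)) _ _ (Hbt k)).
      replace (hx z k) with (z ^ k * RtoC (1 * kron 1 k - a k)
                             + Cconj z ^ k * RtoC (b k * (-1) ^ (m + 1)))%C.
      2: { unfold hx, hterm. rewrite Rmult_1_l, (Rmult_comm (b k)). ring. }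
      apply cseries_ext with (2 := cseries_plus _ _ _ _
         (cseries_scal (z ^ k)%C _ _ (cseries_RtoC _ _ Hx)) (cseries_scal (Cconj z ^ k)%C _ _ (cseries_RtoC _ _ Hy))).
      intros j. unfold hterm. rewrite !RtoC_mult. ring.
  - apply (SHbar_iff _ _ _ _ _ _ _ _ _ _ Heta Hmn). exists a, b. now split.
Qed.
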